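(* Let $H$ be a finite-dimensional Hopf algebra over a field $k$, with a fixed left integral $\Lambda$, and let $A$ be a left $H$-comodule algebra. Then the category $A_H\text{-}\underline{\mathrm{mod}}$ (left $A$-modules modulo null-homotopic morphisms), equipped with the shift functor $T(M)=(H/k\Lambda)\otimes M$ and the class of distinguished triangles described in the context, is a triangulated category (i.e. it satisfies the axioms TR1–TR4).
   Context: All unadorned tensor products are over $k$. A left integral $\Lambda\in H$ is a nonzero element with $h\Lambda=\epsilon(h)\Lambda$ for all $h\in H$, where $\epsilon$ is the counit; it exists and is unique up to a nonzero scalar. A left $H$-comodule algebra is an associative unital $k$-algebra $A$ with a $k$-algebra homomorphism $\Delta_A:A\to H\otimes A$ making $A$ a left $H$-comodule. For an $H$-module $V$ and a (left) $A$-module $M$, $V\otimes M$ is an $A$-module via $\Delta_A$. A morphism $f:M_1\to M_2$ of $A$-modules is null-homotopic if it factors in $A\text{-mod}$ as $M_1\to H\otimes N\to M_2$ for some $A$-module $N$. Null-homotopic morphisms form an ideal, and $A_H\text{-}\underline{\mathrm{mod}}$ is the quotient of the category $A\text{-mod}$ of left $A$-modules by this ideal. Write $\underline{u}$ for the class of an $A$-module map $u$ in $A_H\text{-}\underline{\mathrm{mod}}$. Shift functor: $T(M)=(H/k\Lambda)\otimes M$, where $k\Lambda=H\Lambda$ is a one-dimensional left submodule of $H$. Distinguished triangles: for an $A$-module map $u:X\to Y$, let $x=\Lambda\otimes\mathrm{Id}:X\to H\otimes X$ (the map $m\mapsto\Lambda\otimes m$), let $\overline{x}:H\otimes X\to TX$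 be the quotient map, and let the cone $C_u$ be the pushout of $x:X\to H\otimes X$ and $u:X\to Y$ in $A\text{-mod}$, with structure maps $\overline{u}:H\otimes X\to C_u$ and $v:Y\to C_u$. Let $w:C_u\to TX$ be the unique map with $w\overline{u}=\overline{x}$ and $wv=0$. The sextuple $X\xrightarrow{\underline{u}}Y\xrightarrow{\underline{v}}C_u\xrightarrow{\underline{w}}TX$ is a standard distinguished triangle. A sextuple $X\to Y\to Z\to TX$ in $A_H\text{-}\underline{\mathrm{mod}}$ is a distinguished triangle if it is isomorphic in $A_H\text{-}\underline{\mathrm{mod}}$ to a standard distinguished triangle. *)

(* Defs.v *)
From HB Require Import structures.
From mathcomp Require Import all_boot all_algebra.
From mathcomp Require Import boolp finmap monalg.

Set Implicit Arguments.
Unset Strict Implicit.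
Unset Printing Implicit Defensive.

Import GRing.Theory.
Local Open Scope ring_scope.
Local Open Scope quotient_scope.

(* The carrier and the operations are those of [Quotient.quot]; the operations
   are locked because unification unfolds the unlocked ones at great cost. *)
Definition zquot (V : zmodType) (N : zmodClosed V) : Type := Quotient.quot N.

HB.lock Definition zquot_class (V : zmodType) (N : zmodClosed V) (x : V) :
  zquot N := \pi_(Quotient.quot N) x.
HB.lock Definition zquot_repr (V : zmodType) (N : zmodClosed V) (q : zquot N) : V :=
  repr (q : Quotient.quot N).
HB.lock Definition zquot_zero (V : zmodType) (N : zmodClosed V) : zquot N :=
  (0 : Quotient.quot N).
HB.lock Definition zquot_opp (V : zmodType) (N : zmodClosed V) (p : zquot N) :
  zquot N := - (p : Quotient.quot N).
HB.lock Definition zquot_add (V : zmodType) (N : zmodClosed V) (p q : zquot N) :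
  zquot N := (p : Quotient.quot N) + (q : Quotient.quot N).

Section ZQuot.
Variables (V : zmodType) (N : zmodClosed V).
Local Notation Q := (zquot N).
Local Notation cl := (zquot_class N).

HB.instance Definition _ := Choice.copy Q (Quotient.quot N).

Fact zquot_addA : associative (@zquot_add V N).
Proof. by rewrite zquot_add.unlock => p q r; exact: addrA. Qed.
Fact zquot_addC : commutative (@zquot_add V N).
Proof. by rewrite zquot_add.unlock => p q; exact: addrC. Qed.
Fact zquot_add0 : left_id (zquot_zero N) (@zquot_add V N).
Proof. by rewrite zquot_add.unlock zquot_zero.unlock => p; exact: add0r. Qed.
Fact zquot_addN : left_inverse (zquot_zero N) (@zquot_opp V N) (@zquot_add V N).
Proof.
rewrite zquot_add.unlock zquot_zero.unlock zquot_opp.unlock => p; exact: addNr.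
Qed.
HB.instance Definition _ := GRing.isZmodule.Build Q
  zquot_addA zquot_addC zquot_add0 zquot_addN.

Lemma zquot_classP x y : cl x = cl y <-> x - y \in N.
Proof.
rewrite zquot_class.unlock.
by split => [/eqP|h]; [|apply/eqP]; rewrite eqmodE /= ?Quotient.equivE.
Qed.

Lemma zquot_reprK (q : Q) : cl (zquot_repr q) = q.
Proof. by rewrite zquot_class.unlock zquot_repr.unlock; exact: reprK. Qed.

Lemma zquot_classD x y : cl (x + y) = cl x + cl y.
Proof.
rewrite [RHS]/GRing.add /= zquot_add.unlock zquot_class.unlock.
exact: (raddfD (\pi_(Quotient.quot N))).
Qed.

Fact zquot_class_zmod_morphism : zmod_morphism cl.
Proof. by move=> x y; apply: (addIr (cl y)); rewrite -zquot_classD !subrK. Qed.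
HB.instance Definition _ := GRing.isZmodMorphism.Build V Q cl
  zquot_class_zmod_morphism.

End ZQuot.

Section Span.
Variables (R : pzRingType) (W : lmodType R) (S : W -> Prop).

Definition span : {pred W} :=
  fun x => `[< exists s : seq (R * W),
     (forall p, p \in s -> S p.2) /\ x = \sum_(p <- s) p.1 *: p.2 >].

Lemma spanP x : reflect (exists s : seq (R * W),
  (forall p, p \in s -> S p.2) /\ x = \sum_(p <- s) p.1 *: p.2) (x \in span).
Proof. exact: asboolP. Qed.

Lemma mem_span x : S x -> x \in span.
Proof.
move=> Sx; apply/spanP; exists [:: (1, x)]; split.
  by move=> p; rewrite inE => /eqP->.
by rewrite big_seq1 scale1r.
Qed.

Fact span_submod_closed : submod_closed span.
Proof.
split; first by apply/spanP; exists [::]; rewrite big_nil.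
move=> a u v /spanP[s [sS ->]] /spanP[t [tS ->]]; apply/spanP.
exists ([seq (a * p.1, p.2) | p <- s] ++ t); split.
  move=> p; rewrite mem_cat => /orP[/mapP[q qs ->]|/tS//]; exact: (sS _ qs).
rewrite big_cat big_map scaler_sumr; congr (_ + _).
by apply: eq_bigr => p _; rewrite scalerA.
Qed.

HB.instance Definition _ := GRing.isSubmodClosed.Build R W span span_submod_closed.
HB.instance Definition _ := GRing.isOppClosed.Build W span
  (GRing.zmod_closedN (GRing.submod_closedB span_submod_closed)).

Lemma span_ind (P : W -> Prop) :
  (forall x, S x -> P x) -> P 0 -> (forall x y, P x -> P y -> P (x + y)) ->
  (forall a x, P x -> P (a *: x)) -> forall x, x \in span -> P x.
Proof.
move=> PS P0 PD PZ x /spanP[s [sS ->]].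
rewrite big_seq; apply: big_ind => // p /sS Sp; exact/PZ/PS.
Qed.

End Span.

Definition quotmod (R : pzRingType) (W : lmodType R) (S : W -> Prop) : Type :=
  zquot (span S).

Definition quot_class (R : pzRingType) (W : lmodType R) (S : W -> Prop) (x : W) :
  quotmod S := zquot_class (span S) x.
Definition quot_repr (R : pzRingType) (W : lmodType R) (S : W -> Prop)
  (q : quotmod S) : W := zquot_repr q.

HB.lock Definition quot_scale (R : pzRingType) (W : lmodType R) (S : W -> Prop)
  (a : R) (q : quotmod S) : quotmod S := quot_class S (a *: quot_repr q).

Section QuotMod.
Variables (R : pzRingType) (W : lmodType R) (S : W -> Prop).
Local Notation Q := (quotmod S).
Local Notation cl := (quot_class S).

HB.instance Definition _ := GRing.Zmodule.on Q.

Lemma quot_classP x y : cl x = cl y <-> x - y \in span S.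
Proof. exact: zquot_classP. Qed.

Lemma quot_reprK (q : Q) : cl (quot_repr q) = q.
Proof. exact: zquot_reprK. Qed.

Lemma quot_classD x y : cl (x + y) = cl x + cl y.
Proof. exact: zquot_classD. Qed.

Lemma quot_scaleE a x : quot_scale a (cl x) = cl (a *: x).
Proof.
rewrite quot_scale.unlock; apply/quot_classP; rewrite -scalerBr rpredZ //.
apply/quot_classP; exact: quot_reprK.
Qed.

Fact quot_scaleA a b (q : Q) : quot_scale a (quot_scale b q) = quot_scale (a * b) q.
Proof. by rewrite -(quot_reprK q) !quot_scaleE scalerA. Qed.
Fact quot_scale1 : left_id 1 (@quot_scale R W S).
Proof. by move=> q; rewrite -(quot_reprK q) quot_scaleE scale1r. Qed.
Fact quot_scaleDr : right_distributive (@quot_scale R W S) +%R.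
Proof.
move=> a p q; rewrite -(quot_reprK p) -(quot_reprK q) -quot_classD !quot_scaleE.
by rewrite -quot_classD scalerDr.
Qed.
Fact quot_scaleDl (q : Q) : {morph (@quot_scale R W S)^~ q : a b / a + b}.
Proof.
by move=> a b; rewrite -(quot_reprK q) !quot_scaleE -quot_classD scalerDl.
Qed.

HB.instance Definition _ := GRing.Zmodule_isLmodule.Build R Q
  quot_scaleA quot_scale1 quot_scaleDr quot_scaleDl.

Fact quot_class_linear : linear cl.
Proof. by move=> a x y; rewrite quot_classD -quot_scaleE. Qed.
HB.instance Definition _ := GRing.isLinear.Build R W Q *:%R cl quot_class_linear.

End QuotMod.

Section Tensor.
Variables (k : fieldType) (U V : lmodType k).
Local Notation free := {malg k[(U * V)%type]}.

Inductive tensor_relator : free -> Prop :=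
| TensorDl u u' v : tensor_relator (<< (u + u', v) >> - << (u, v) >> - << (u', v) >>)
| TensorDr u v v' : tensor_relator (<< (u, v + v') >> - << (u, v) >> - << (u, v') >>)
| TensorZl c u v : tensor_relator (<< (c *: u, v) >> - c *: << (u, v) >>)
| TensorZr c u v : tensor_relator (<< (u, c *: v) >> - c *: << (u, v) >>).

Definition tensor : Type := quotmod tensor_relator.
HB.instance Definition _ := GRing.Lmodule.on tensor.

End Tensor.

HB.lock Definition pure (k : fieldType) (U V : lmodType k) (u : U) (v : V) :
  tensor U V := quot_class (@tensor_relator k U V) << (u, v) >>.

Section TensorTheory.
Variables (k : fieldType) (U V : lmodType k).
Local Notation free := {malg k[(U * V)%type]}.
Local Notation tensor := (tensor U V).

Lemma pureDl (u u' : U) (v : V) : pure (u + u') v = pure u v + pure u' v.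
Proof.
rewrite pure.unlock -linearD; apply/quot_classP; rewrite opprD addrA.
exact/mem_span/TensorDl.
Qed.
Lemma pureDr (u : U) (v v' : V) : pure u (v + v') = pure u v + pure u v'.
Proof.
rewrite pure.unlock -linearD; apply/quot_classP; rewrite opprD addrA.
exact/mem_span/TensorDr.
Qed.
Lemma pureZl c (u : U) (v : V) : pure (c *: u) v = c *: pure u v.
Proof. rewrite pure.unlock -linearZ; apply/quot_classP; exact/mem_span/TensorZl. Qed.
Lemma pureZr c (u : U) (v : V) : pure u (c *: v) = c *: pure u v.
Proof. rewrite pure.unlock -linearZ; apply/quot_classP; exact/mem_span/TensorZr. Qed.

Lemma tensor_ind (P : tensor -> Prop) :
  (forall (u : U) (v : V), P (pure u v)) -> (forall s t, P s -> P t -> P (s + t)) ->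
  forall t, P t.
Proof.
move=> Pp PD t; rewrite -(quot_reprK t); move: (quot_repr t) => g.
have P0 : P 0 by rewrite -[0](scale0r (pure 0 0)) -pureZl.
rewrite [g]monalgE linear_sum; apply: big_ind => // -[u v] _.
have -> : << g@_(u, v) *g (u, v) >> = g@_(u, v) *: << (u, v) >> :> free.
  by apply/malgP => p; rewrite mcoeffZ !mcoeffU mulr_natr.
by have := Pp (g@_(u, v) *: u) v; rewrite pureZl pure.unlock linearZ.
Qed.

End TensorTheory.

Definition free_lift (k : fieldType) (U V W : lmodType k) (f : U -> V -> W)
    (g : {malg k[(U * V)%type]}) : W :=
  \sum_(p <- msupp g) g@_p *: f p.1 p.2.

(* [tlift f] is meant for bilinear [f]; it is then the linear map induced by
   [f] (see [tlift_pure] and [tlift_linear]). *)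
HB.lock Definition tlift (k : fieldType) (U V W : lmodType k) (f : U -> V -> W)
    (t : tensor U V) : W := free_lift f (quot_repr t).

Section Lift.
Variables (k : fieldType) (U V : lmodType k).
Local Notation free := {malg k[(U * V)%type]}.

Section BilinearLift.
Variables (W : lmodType k) (f : U -> V -> W).

Fact free_lift_linear : linear (free_lift f).
Proof.
have E (d : {fset _}) g : (msupp g `<=` d)%fset ->
    free_lift f g = \sum_(p <- d) g@_p *: f p.1 p.2.
  move=> le; rewrite [LHS](big_fset_incl _ le) => //= x _ /mcoeff_outdom ->.
  by rewrite scale0r.
move=> a g h; pose d := (msupp g `|` msupp h)%fset.
have lg : (msupp g `<=` d)%fset by exact: fsubsetUl.
have lh : (msupp h `<=` d)%fset by exact: fsubsetUr.
have lgh : (msupp (a *: g + h) `<=` d)%fset.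
  apply: fsubset_trans (msuppD_le _ _) _; rewrite fsetSU //.
  exact: msuppZ_le.
rewrite (E d) // (E d g) // (E d h) // scaler_sumr -big_split /=.
by apply: eq_bigr => p _; rewrite mcoeffD mcoeffZ scalerDl scalerA.
Qed.
HB.instance Definition _ := GRing.isLinear.Build k free W *:%R (free_lift f)
  free_lift_linear.

Lemma free_liftU u v : free_lift f << (u, v) >> = f u v.
Proof.
rewrite /free_lift (big_fset_incl _ msuppU_le) /=; last first.
  by move=> x _ /mcoeff_outdom ->; rewrite scale0r.
by rewrite big_seq_fset1 mcoeffUU scale1r.
Qed.

Hypothesis f_bil : bilinear_for *:%R *:%R f.

Lemma tlift_class g : tlift f (quot_class (@tensor_relator _ U V) g) = free_lift f g.
Proof.
apply/eqP; rewrite -subr_eq0 tlift.unlock -linearB; apply/eqP.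
have : quot_repr (quot_class (@tensor_relator _ U V) g) - g \in span (@tensor_relator _ U V).
  by apply/quot_classP; rewrite quot_reprK.
move: (quot_repr _ - g); apply: span_ind => [x rx||x y|a x].
- have fD1 u u' v : f (u + u') v = f u v + f u' v.
    by have := f_bil.1 v 1 u u'; rewrite /= !scale1r.
  have fD2 u v v' : f u (v + v') = f u v + f u v'.
    by have := f_bil.2 u 1 v v'; rewrite /= !scale1r.
  have f0l v : f 0 v = 0 by apply: (addIr (f 0 v)); rewrite -fD1 !add0r.
  have f0r u : f u 0 = 0 by apply: (addIr (f u 0)); rewrite -fD2 !add0r.
  have fZ1 c u v : f (c *: u) v = c *: f u v.
    by have := f_bil.1 v c u 0; rewrite /= !addr0 f0l addr0.
  have fZ2 c u v : f u (c *: v) = c *: f u v.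
    by have := f_bil.2 u c v 0; rewrite /= !addr0 f0r addr0.
  case: rx => *; rewrite !linearB ?linearZ /= !free_liftU /=
    ?(fD1, fD2, fZ1, fZ2) ?scalerN ?subrr //.
  - by rewrite addrAC addrK subrr.
  - by rewrite addrAC addrK subrr.
- exact: linear0.
- by rewrite linearD => -> ->; rewrite addr0.
- by rewrite linearZ /= => ->; rewrite scaler0.
Qed.

Lemma tlift_pure u v : tlift f (pure u v) = f u v.
Proof. by rewrite pure.unlock tlift_class free_liftU. Qed.

Fact tlift_linear : linear (tlift f).
Proof.
move=> a s t; rewrite -(quot_reprK s) -(quot_reprK t) -linearP !tlift_class.
exact: linearP.
Qed.

End BilinearLift.

Lemma tensor_eq_lin (W : lmodType k) (f g : tensor U V -> W) :
  linear f -> linear g -> (forall u v, f (pure u v) = g (pure u v)) -> f =1 g.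
Proof.
move=> fl gl fg; apply: tensor_ind => // s t fs ft.
by rewrite -[s]scale1r fl gl fs ft.
Qed.

End Lift.

Section TensorMap.
Variables (k : fieldType).

Definition tmap (U V U' V' : lmodType k) (f : U -> U') (g : V -> V') :
  tensor U V -> tensor U' V' := tlift (fun u v => pure (f u) (g v)).

Section Props.
Variables (U V U' V' : lmodType k) (f : U -> U') (g : V -> V').
Hypotheses (fl : linear f) (gl : linear g).

Fact tmap_bilinear : bilinear_for *:%R *:%R (fun u v => pure (f u) (g v)).
Proof.
split=> [v a x y|u a x y] /=; first by rewrite fl pureDl pureZl.
by rewrite gl pureDr pureZr.
Qed.

Lemma tmap_pure u v : tmap f g (pure u v) = pure (f u) (g v).
Proof. by rewrite [LHS]tlift_pure//; exact: tmap_bilinear. Qed.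

Fact tmap_linear : linear (tmap f g).
Proof. by apply: tlift_linear; exact: tmap_bilinear. Qed.
End Props.

Definition tassoc (U V W : lmodType k) :
    tensor U (tensor V W) -> tensor (tensor U V) W :=
  tlift (fun u t => tmap (pure u) id t).

End TensorMap.

Section Action.
Variables (k : fieldType) (B A V M : lmodType k).
Variables (bV : B -> V -> V) (aM : A -> M -> M).

Definition tact (x : tensor B A) (t : tensor V M) : tensor V M :=
  tlift (fun b a => tmap (bV b) (aM a) t) x.

Hypotheses (bV_bil : bilinear_for *:%R *:%R bV)
           (aM_bil : bilinear_for *:%R *:%R aM).

Fact tact_bilinear t : bilinear_for *:%R *:%R (fun b a => tmap (bV b) (aM a) t).
Proof.
have tl b a c x y : tmap (bV b) (aM a) (c *: x + y) =
    c *: tmap (bV b) (aM a) x + tmap (bV b) (aM a) y.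
  exact: (tmap_linear (bV_bil.2 b) (aM_bil.2 a)).
have tp b a := tmap_pure (bV_bil.2 b) (aM_bil.2 a).
split=> [a|b] c x y /=; move: t.
- apply: (tensor_eq_lin (f := tmap (bV (c *: x + y)) (aM a))
    (g := fun t => c *: tmap (bV x) (aM a) t + tmap (bV y) (aM a) t)).
  + exact: tl.
  + move=> d s t; rewrite (tl x a d s t) (tl y a d s t).
    by rewrite !scalerDr !scalerA (mulrC c) addrACA.
  + by move=> u v; rewrite !tp (bV_bil.1 u) pureDl pureZl.
- apply: (tensor_eq_lin (f := tmap (bV b) (aM (c *: x + y)))
    (g := fun t => c *: tmap (bV b) (aM x) t + tmap (bV b) (aM y) t)).
  + exact: tl.
  + move=> d s t; rewrite (tl b x d s t) (tl b y d s t).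
    by rewrite !scalerDr !scalerA (mulrC c) addrACA.
  + by move=> u v; rewrite !tp (aM_bil.1 v) pureDr pureZr.
Qed.

Lemma tact_pure b a v m :
  tact (pure b a) (pure v m) = pure (bV b v) (aM a m).
Proof.
rewrite /tact tlift_pure; last exact: tact_bilinear.
by rewrite tmap_pure; [|exact: bV_bil.2|exact: aM_bil.2].
Qed.

Fact tact_linearl t : linear (tact^~ t).
Proof. exact: tlift_linear (tact_bilinear t). Qed.

Fact tact_linearr x : linear (tact x).
Proof.
move=> c s t; move: x; apply: (tensor_eq_lin (f := tact^~ (c *: s + t))
  (g := fun x => c *: tact x s + tact x t)) => [|d x y|b a].
- exact: tact_linearl.
- by rewrite !(tact_linearl _ d) !scalerDr !scalerA (mulrC c) addrACA.
- have tl := tmap_linear (bV_bil.2 b) (aM_bil.2 a).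
  by rewrite /tact !(tlift_pure (tact_bilinear _)) tl.
Qed.

End Action.

(* An associative unital [k]-algebra, given by a central ring morphism
   [k -> A]. Unlike [algType k], this allows the zero algebra. *)
HB.mixin Record PzRing_isKAlgebra (k : fieldType) A of GRing.PzRing A := {
  kscal : k -> A;
  kscalD : {morph kscal : c d / c + d};
  kscalM : {morph kscal : c d / c * d};
  kscal1 : kscal 1 = 1;
  kscalC : forall c (a : A), kscal c * a = a * kscal c
}.
#[short(type="kalgType")]
HB.structure Definition KAlgebra (k : fieldType) :=
  { A of GRing.PzRing A & PzRing_isKAlgebra k A }.

(* The [k]-vector space underlying a module over a [k]-algebra; in particular
   [restr A^o] is the [k]-vector space underlying the [k]-algebra [A]. *)
Definition restr (k : fieldType) (A : kalgType k) (M : lmodType A) : Type := M.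

Section Restr.
Variables (k : fieldType) (A : kalgType k) (M : lmodType A).

HB.instance Definition _ := GRing.Zmodule.on (restr M).

Definition restr_scale (c : k) (m : restr M) : restr M :=
  (kscal c : A) *: (m : M).

Fact restr_scaleA c d m :
  restr_scale c (restr_scale d m) = restr_scale (c * d) m.
Proof. by rewrite /restr_scale scalerA kscalM. Qed.
Fact restr_scale1 m : restr_scale 1 m = m.
Proof. by rewrite /restr_scale kscal1 scale1r. Qed.
Fact restr_scaleDr : right_distributive restr_scale +%R.
Proof. by move=> c m n; exact: scalerDr. Qed.
Fact restr_scaleDl m : {morph restr_scale^~ m : c d / c + d}.
Proof. by move=> c d; rewrite /restr_scale kscalD; exact: scalerDl. Qed.

HB.instance Definition _ := GRing.Zmodule_isLmodule.Build k (restr M)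
  restr_scaleA restr_scale1 restr_scaleDr restr_scaleDl.

End Restr.

Section RestrAct.
Variables (k : fieldType) (A : kalgType k) (M : lmodType A).

Definition restr_act (a : restr A^o) (m : restr M) : restr M := (a : A) *: (m : M).

Fact restr_act_bilinear : bilinear_for *:%R *:%R restr_act.
Proof.
split=> [m c a b|a c m n].
  change (((kscal c : A) * (a : A) + (b : A)) *: (m : M) =
    (kscal c : A) *: ((a : A) *: (m : M)) + (b : A) *: (m : M)).
  by rewrite scalerDl scalerA.
change ((a : A) *: ((kscal c : A) *: (m : M) + (n : M)) =
  (kscal c : A) *: ((a : A) *: (m : M)) + (a : A) *: (n : M)).
by rewrite scalerDr !scalerA kscalC.
Qed.

End RestrAct.

Fact restr_linear (k : fieldType) (A : kalgType k) (M N : lmodType A)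
    (f : {linear M -> N}) : linear (f : restr M -> restr N).
Proof. by move=> c m n; exact: (linearP f (kscal c : A)). Qed.

(* The action of [B ⊗ A] on [V ⊗ M], for a [B]-module [V] and an [A]-module
   [M]; with [V = B] and [M = A] it is the product of [B ⊗ A]. *)
Section TensorAction.
Variables (k : fieldType) (B A : kalgType k).
Local Notation BA := (tensor (restr B^o) (restr A^o)).

Section OnModule.
Variables (V : lmodType B) (M : lmodType A).
Local Notation VM := (tensor (restr V) (restr M)).

Definition tens_act (x : BA) (t : VM) : VM :=
  tact (@restr_act k B V) (@restr_act k A M) x t.

Lemma tens_act_pure (b : B) (a : A) (v : V) (m : M) :
  tens_act (pure (b : restr B^o) (a : restr A^o)) (pure (v : restr V) (m : restr M)) =
  pure ((b *: v : V) : restr V) ((a *: m : M) : restr M).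
Proof. by rewrite /tens_act tact_pure //; exact: restr_act_bilinear. Qed.

Fact tens_act_linearl t : linear (tens_act^~ t).
Proof. by apply: tact_linearl; exact: restr_act_bilinear. Qed.
Fact tens_act_linearr x : linear (tens_act x).
Proof. by apply: tact_linearr; exact: restr_act_bilinear. Qed.

Lemma tens_actDl t x y : tens_act (x + y) t = tens_act x t + tens_act y t.
Proof. by have := tens_act_linearl t 1 x y; rewrite !scale1r. Qed.
Lemma tens_actDr x s t : tens_act x (s + t) = tens_act x s + tens_act x t.
Proof. by have := tens_act_linearr x 1 s t; rewrite !scale1r. Qed.
End OnModule.

Definition tmul (x y : BA) : BA := tens_act (V := B^o) (M := A^o) x y.
Definition tone : BA := pure (1 : restr B^o) (1 : restr A^o).

Lemma tmul_pure (b b' : B) (a a' : A) :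
  tmul (pure (b : restr B^o) (a : restr A^o)) (pure (b' : restr B^o) (a' : restr A^o))
  = pure ((b * b' : B) : restr B^o) ((a * a' : A) : restr A^o).
Proof. exact: (tens_act_pure (V := B^o) (M := A^o)). Qed.

Fact tens_actA (V : lmodType B) (M : lmodType A) x y (t : tensor (restr V) (restr M)) :
  tens_act x (tens_act y t) = tens_act (tmul x y) t.
Proof.
elim/tensor_ind: t => [v m|s t IHs IHt]; last by rewrite !tens_actDr IHs IHt.
elim/tensor_ind: x => [b a|x x' IH IH']; last first.
  by rewrite /tmul !tens_actDl -!/(tmul _ _) IH IH'.
elim/tensor_ind: y => [b' a'|y y' IH IH']; last first.
  by rewrite /tmul tens_actDr !tens_actDl tens_actDr -!/(tmul _ _) IH IH'.
by rewrite tmul_pure !tens_act_pure !scalerA.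
Qed.
Fact tens_act1 (V : lmodType B) (M : lmodType A) (t : tensor (restr V) (restr M)) :
  tens_act tone t = t.
Proof.
elim/tensor_ind: t => [v m|s t IHs IHt]; last by rewrite !tens_actDr IHs IHt.
by rewrite tens_act_pure !scale1r.
Qed.
End TensorAction.

(* [tone] and [tmul] are the unit and the product of the algebra [H ⊗ H]. *)
HB.mixin Record KAlgebra_isHopf (k : fieldType) H of KAlgebra k H := {
  comul : restr H^o -> tensor (restr H^o) (restr H^o);
  counit : restr H^o -> k;
  antipode : restr H^o -> restr H^o;
  comul_linear : linear comul;
  comulM : forall x y : H, comul (x * y) = tmul (comul x) (comul y);
  comul1 : comul (1 : H) = tone H H;
  counit_linear : scalar counit;
  counitM : forall x y : H, counit (x * y) = counit x * counit y;
  counit1 : counit (1 : H) = 1;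
  antipode_linear : linear antipode;
  comulA : forall h, tassoc (tmap id comul (comul h)) = tmap comul id (comul h);
  counitl : forall h, tlift (fun x y => counit x *: y) (comul h) = h;
  counitr : forall h, tlift (fun x y => counit y *: x) (comul h) = h;
  antipodel : forall h,
    tlift (fun x y : restr H^o => (antipode x : H) * (y : H) : restr H^o) (comul h)
    = counit h *: (1 : restr H^o);
  antipoder : forall h,
    tlift (fun x y : restr H^o => (x : H) * (antipode y : H) : restr H^o) (comul h)
    = counit h *: (1 : restr H^o)
}.
#[short(type="hopfAlgType")]
HB.structure Definition HopfAlgebra (k : fieldType) :=
  { H of KAlgebra k H & KAlgebra_isHopf k H }.

Definition finite_dimensional (k : fieldType) (V : lmodType k) : Prop :=
  exists (n : nat) (f : V -> 'rV[k]_n), linear f /\ bijective f.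

HB.mixin Record KAlgebra_isComodAlgebra (k : fieldType) (H : hopfAlgType k) A
    of KAlgebra k A := {
  coact : restr A^o -> tensor (restr H^o) (restr A^o);
  coact_linear : linear coact;
  coactM : forall a b : A, coact (a * b) = tmul (coact a) (coact b);
  coact1 : coact (1 : A) = tone H A;
  coactA : forall a, tassoc (tmap id coact (coact a)) = tmap comul id (coact a);
  coact_counit : forall a, tlift (fun h b => counit h *: b) (coact a) = a
}.
#[short(type="comodAlgType")]
HB.structure Definition ComodAlgebra (k : fieldType) (H : hopfAlgType k) :=
  { A of KAlgebra k A & KAlgebra_isComodAlgebra k H A }.

Definition left_integral (k : fieldType) (H : hopfAlgType k) (Lam : H) : Prop :=
  Lam != 0 /\ forall h : H, h * Lam = kscal (counit h) * Lam.

Section TensorModule.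
Variables (k : fieldType) (H : hopfAlgType k) (A : comodAlgType H).

(* The [A]-module [V ⊗ M]: [a (v ⊗ m) = Σ a_(-1) v ⊗ a_(0) m], where
   [coact a = Σ a_(-1) ⊗ a_(0)]. *)
Definition tensM (V : lmodType H) (M : lmodType A) : Type :=
  tensor (restr V) (restr M).

Section Structure.
Variables (V : lmodType H) (M : lmodType A).
HB.instance Definition _ := GRing.Zmodule.on (tensM V M).

Definition tensM_scale (a : A) (t : tensM V M) : tensM V M :=
  tens_act (coact a) t.

Fact coactD (a b : A) : coact (a + b) = coact a + coact b.
Proof. by have := coact_linear 1 a b; rewrite !scale1r. Qed.

Fact tensM_scaleA a b t : tensM_scale a (tensM_scale b t) = tensM_scale (a * b) t.
Proof. by rewrite /tensM_scale tens_actA coactM. Qed.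
Fact tensM_scale1 t : tensM_scale 1 t = t.
Proof. by rewrite /tensM_scale coact1 tens_act1. Qed.
Fact tensM_scaleDr : right_distributive tensM_scale +%R.
Proof. by move=> a s t; rewrite /tensM_scale tens_actDr. Qed.
Fact tensM_scaleDl t : {morph tensM_scale^~ t : a b / a + b}.
Proof. by move=> a b; rewrite /tensM_scale coactD tens_actDl. Qed.

HB.instance Definition _ := GRing.Zmodule_isLmodule.Build A (tensM V M)
  tensM_scaleA tensM_scale1 tensM_scaleDr tensM_scaleDl.

Definition tens_pure (v : V) (m : M) : tensM V M :=
  pure (v : restr V) (m : restr M).

Lemma tensM_ind (P : tensM V M -> Prop) :
  (forall v m, P (tens_pure v m)) -> (forall s t, P s -> P t -> P (s + t)) ->
  forall t, P t.
Proof. exact (@tensor_ind k (restr V) (restr M) P). Qed.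

End Structure.

Section Functoriality.
Variables (V V' : lmodType H) (M M' : lmodType A).
Variables (f : {linear V -> V'}) (g : {linear M -> M'}).

Definition tensM_map : tensM V M -> tensM V' M' :=
  tmap (f : restr V -> restr V') (g : restr M -> restr M').

Lemma tensM_map_pure v m : tensM_map (tens_pure v m) = tens_pure (f v) (g m).
Proof. by rewrite /tensM_map [LHS]tmap_pure //; exact: restr_linear. Qed.

Fact tensM_map_linear : linear tensM_map.
Proof.
have mD s t : tensM_map (s + t) = tensM_map s + tensM_map t.
  have := tmap_linear (restr_linear f) (restr_linear g) 1 s t.
  by rewrite !scale1r.
move=> a s t; rewrite mD; congr (_ + _) => {t}.
change (tensM_map (tens_act (coact a) s) = tens_act (coact a) (tensM_map s)).
elim/tensM_ind: s => [v m|s t IHs IHt]; last first.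
  by rewrite mD !tens_actDr mD IHs IHt.
elim/tensor_ind: (coact a) => [h b|x y IHx IHy].
  rewrite tens_act_pure -/(tens_pure _ _) !tensM_map_pure.
  by rewrite tens_act_pure !linearZ.
by rewrite !tens_actDl mD IHx IHy.
Qed.
HB.instance Definition _ := GRing.isLinear.Build A (tensM V M) (tensM V' M') *:%R
  tensM_map tensM_map_linear.

Lemma tensM_mapD s t : tensM_map (s + t) = tensM_map s + tensM_map t.
Proof. exact: linearD. Qed.

End Functoriality.
End TensorModule.

Record preaddCat := PreaddCat {
  ob :> Type;
  hom : ob -> ob -> zmodType;
  idm : forall X, hom X X;
  comp : forall X Y Z, hom Y Z -> hom X Y -> hom X Z;
  compA : forall W X Y Z (h : hom Y Z) (g : hom X Y) (f : hom W X),
    comp h (comp g f) = comp (comp h g) f;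
  comp1m : forall X Y (f : hom X Y), comp (idm Y) f = f;
  compm1 : forall X Y (f : hom X Y), comp f (idm X) = f;
  compDl : forall X Y Z (g g' : hom Y Z) (f : hom X Y),
    comp (g + g') f = comp g f + comp g' f;
  compDr : forall X Y Z (g : hom Y Z) (f f' : hom X Y),
    comp g (f + f') = comp g f + comp g f'
}.

Local Notation "g '∘' f" := (comp g f) (at level 40, left associativity).

Section Additive.
Variable C : preaddCat.

Definition is_iso (X Y : C) (f : hom X Y) : Prop :=
  exists g : hom Y X, g ∘ f = idm X /\ f ∘ g = idm Y.

Definition is_zero_object (Z : C) : Prop :=
  forall X : C, (forall f : hom X Z, f = 0) /\ (forall f : hom Z X, f = 0).

Definition is_biproduct (X Y S : C) (i : hom X S) (j : hom Y S)
    (p : hom S X) (q : hom S Y) : Prop :=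
  [/\ p ∘ i = idm X, q ∘ j = idm Y, p ∘ j = 0, q ∘ i = 0
    & i ∘ p + j ∘ q = idm S].

Definition is_additive_category : Prop :=
  (exists Z : C, is_zero_object Z) /\
  (forall X Y : C, exists (S : C) (i : hom X S) (j : hom Y S)
     (p : hom S X) (q : hom S Y), is_biproduct i j p q).

(* Only the data; the laws are in [is_functor]. *)
Record endo := Endo {
  eob :> C -> C;
  emap : forall X Y : C, hom X Y -> hom (eob X) (eob Y)
}.

Definition is_functor (F : endo) : Prop :=
  (forall X : C, emap F (idm X) = idm (F X)) /\
  (forall (X Y Z : C) (g : hom Y Z) (f : hom X Y),
     emap F (g ∘ f) = emap F g ∘ emap F f).

Definition is_additive_functor (F : endo) : Prop :=
  is_functor F /\
  forall (X Y : C) (f g : hom X Y), emap F (f + g) = emap F f + emap F g.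

(* The shift is only required to be invertible up to natural isomorphism: on
   the stable category it is not an automorphism. *)
Definition is_autoequivalence (F : endo) : Prop :=
  is_functor F /\
  exists (G : endo) (eta : forall X : C, hom X (G (F X)))
    (eps : forall X : C, hom (F (G X)) X),
    [/\ is_functor G,
      forall X, is_iso (eta X) /\ is_iso (eps X),
      forall (X Y : C) (f : hom X Y),
        emap G (emap F f) ∘ eta X = eta Y ∘ f
    & forall (X Y : C) (f : hom X Y),
        f ∘ eps X = eps Y ∘ emap F (emap G f)].

End Additive.

Section Triangulated.
Variables (C : preaddCat) (T : endo C).

Record triangle := Triangle {
  trX : C; trY : C; trZ : C;
  tru : hom trX trY;
  trv : hom trY trZ;
  trw : hom trZ (T trX)
}.

Definition triangle_iso (S S' : triangle) : Prop :=
  exists (f : hom (trX S) (trX S')) (g : hom (trY S) (trY S'))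
    (h : hom (trZ S) (trZ S')),
    [/\ is_iso f, is_iso g & is_iso h] /\
    [/\ g ∘ tru S = tru S' ∘ f, h ∘ trv S = trv S' ∘ g
      & emap T f ∘ trw S = trw S' ∘ h].

Record triangulated (dist : triangle -> Prop) : Prop := {
  triangulated_additive : is_additive_category C;
  triangulated_shift : is_additive_functor T /\ is_autoequivalence T;
  triangulated_TR1_iso : forall S S' : triangle,
    triangle_iso S S' -> dist S' -> dist S;
  triangulated_TR1_id : forall X Z : C, is_zero_object Z ->
    dist (Triangle (idm X) (0 : hom X Z) (0 : hom Z (T X)));
  triangulated_TR1_cone : forall (X Y : C) (u : hom X Y),
    exists (Z : C) (v : hom Y Z) (w : hom Z (T X)), dist (Triangle u v w);
  triangulated_TR2 : forall (X Y Z : C) (u : hom X Y) (v : hom Y Z)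
      (w : hom Z (T X)),
    dist (Triangle u v w) <-> dist (Triangle v w (- emap T u));
  triangulated_TR3 : forall (X Y Z X' Y' Z' : C)
      (u : hom X Y) (v : hom Y Z) (w : hom Z (T X))
      (u' : hom X' Y') (v' : hom Y' Z') (w' : hom Z' (T X'))
      (f : hom X X') (g : hom Y Y'),
    dist (Triangle u v w) -> dist (Triangle u' v' w') ->
    g ∘ u = u' ∘ f ->
    exists h : hom Z Z', h ∘ v = v' ∘ g /\ emap T f ∘ w = w' ∘ h;
  triangulated_TR4 : forall (X Y Z X' Y' Z' : C)
      (u : hom X Y) (j : hom Y Z') (k : hom Z' (T X))
      (v : hom Y Z) (l : hom Z X') (i : hom X' (T Y))
      (m : hom Z Y') (n : hom Y' (T X)),
    dist (Triangle u j k) -> dist (Triangle v l i) ->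
    dist (Triangle (v ∘ u) m n) ->
    exists (f : hom Z' Y') (g : hom Y' X'),
      dist (Triangle f g (emap T j ∘ i)) /\
      [/\ f ∘ j = m ∘ v, n ∘ f = k, g ∘ m = l & i ∘ g = emap T u ∘ n]
}.

End Triangulated.

Definition linhom (R : pzRingType) (M N : lmodType R) : Type := {linear M -> N}.

Definition linfun_of (R : pzRingType) (M N : lmodType R) (f : linhom M N) :
  {linear M -> N} := f.

Section LinHom.
Variables (R : pzRingType) (M N : lmodType R).
Implicit Types f g h : linhom M N.

HB.instance Definition _ := gen_eqMixin (linhom M N).
HB.instance Definition _ := gen_choiceMixin (linhom M N).

Lemma linhom_ext f g : linfun_of f =1 linfun_of g -> f = g.
Proof.
rewrite /linfun_of; case: f => f cf; case: g => g cg /= fg.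
have {}fg : f = g by apply/funext.
rewrite -{}fg in cg *; congr (GRing.Linear.Pack _).
case: cf => [[a1] [b1]]; case: cg => [[a2] [b2]].
by rewrite (Prop_irrelevance a1 a2) (Prop_irrelevance b1 b2).
Qed.

Definition lin_zero : linhom M N := (\0 : {linear M -> N}).
Definition lin_opp f : linhom M N := (\- linfun_of f : {linear M -> N}).
Definition lin_add f g : linhom M N :=
  (linfun_of f \+ linfun_of g : {linear M -> N}).

Fact lin_addA : associative lin_add.
Proof. by move=> f g h; apply: linhom_ext => x; exact: addrA. Qed.
Fact lin_addC : commutative lin_add.
Proof. by move=> f g; apply: linhom_ext => x; exact: addrC. Qed.
Fact lin_add0 : left_id lin_zero lin_add.
Proof. by move=> f; apply: linhom_ext => x; exact: add0r. Qed.
Fact lin_addN : left_inverse lin_zero lin_opp lin_add.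
Proof. by move=> f; apply: linhom_ext => x; exact: addNr. Qed.

HB.instance Definition _ := GRing.isZmodule.Build (linhom M N)
  lin_addA lin_addC lin_add0 lin_addN.
End LinHom.

Definition lin_id (R : pzRingType) (M : lmodType R) : linhom M M :=
  (idfun : {linear M -> M}).
Definition lin_comp (R : pzRingType) (M N P : lmodType R)
    (g : linhom N P) (f : linhom M N) : linhom M P :=
  (linfun_of g \o linfun_of f : {linear M -> P}).

Section StableCategory.
Variables (k : fieldType) (H : hopfAlgType k) (A : comodAlgType H).

Definition null_homotopic (M N : lmodType A) (f : M -> N) : Prop :=
  exists (P : lmodType A) (a : {linear M -> tensM H^o P})
         (b : {linear tensM H^o P -> N}), f =1 b \o a.

Section NullHomotopic.
Variables (M N : lmodType A).

Definition null_pred : {pred linhom M N} :=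
  fun f => `[< null_homotopic (linfun_of f) >].

Fact null_pred_zmod_closed : zmod_closed null_pred.
Proof.
split; first by apply/asboolP; exists M, \0, \0 => x.
move=> f g /asboolP[P [a [b fE]]] /asboolP[P' [a' [b' gE]]]; apply/asboolP.
pose i1 (x : P) : (P * P')%type := (x, 0).
pose i2 (x : P') : (P * P')%type := (0, x).
pose p1 (x : (P * P')%type) : P := x.1.
pose p2 (x : (P * P')%type) : P' := x.2.
have i1l : linear i1.
  move=> c x y; rewrite /i1; apply/eqP; rewrite xpair_eqE /= eqxx /=.
  by rewrite scaler0 addr0.
have i2l : linear i2.
  move=> c x y; rewrite /i2; apply/eqP; rewrite xpair_eqE /= eqxx andbT.
  by rewrite scaler0 addr0.
have p1l : linear p1 by [].
have p2l : linear p2 by [].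
pose I1 : {linear P -> (P * P')%type} :=
  HB.pack i1 (GRing.isLinear.Build _ _ _ _ _ i1l).
pose I2 : {linear P' -> (P * P')%type} :=
  HB.pack i2 (GRing.isLinear.Build _ _ _ _ _ i2l).
pose P1 : {linear (P * P')%type -> P} :=
  HB.pack p1 (GRing.isLinear.Build _ _ _ _ _ p1l).
pose P2 : {linear (P * P')%type -> P'} :=
  HB.pack p2 (GRing.isLinear.Build _ _ _ _ _ p2l).
pose hid : {linear H^o -> H^o} := idfun.
have mm (Q Q' Q'' : lmodType A) (u : {linear Q -> Q'}) (v : {linear Q' -> Q''}) t :
    tensM_map hid v (tensM_map hid u t) = tensM_map hid (v \o u) t.
  elim/tensM_ind: t => [h q|s t IHs IHt]; last by rewrite !tensM_mapD IHs IHt.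
  by rewrite !tensM_map_pure.
have m1 (Q : lmodType A) (u : {linear Q -> Q}) t :
    u =1 id -> tensM_map hid u t = t.
  move=> E; elim/tensM_ind: t => [h q|s t IHs IHt]; last first.
    by rewrite !tensM_mapD IHs IHt.
  by rewrite !tensM_map_pure E.
have m0 (Q Q' : lmodType A) (u : {linear Q -> Q'}) t :
    u =1 (fun=> 0) -> tensM_map hid u t = 0.
  move=> E; elim/tensM_ind: t => [h q|s t IHs IHt]; last first.
    by rewrite tensM_mapD IHs IHt addr0.
  rewrite tensM_map_pure E /tens_pure -[X in pure _ X](scale0r (0 : restr Q')).
  by rewrite pureZr scale0r.
exists (P * P')%type, ((tensM_map hid I1 \o a) \+ (tensM_map hid I2 \o a')),
  ((b \o tensM_map hid P1) \- (b' \o tensM_map hid P2)) => x /=.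
rewrite !tensM_mapD.
rewrite !mm.
rewrite (m1 _ (P1 \o I1)) // (m0 _ _ (P1 \o I2)) //.
rewrite (m0 _ _ (P2 \o I1)) // (m1 _ (P2 \o I2)) //.
by rewrite addr0 add0r -[b _]fE -[b' _]gE.
Qed.
HB.instance Definition _ :=
  GRing.isZmodClosed.Build (linhom M N) null_pred null_pred_zmod_closed.

Definition stable_hom : zmodType := zquot null_pred.

Definition stable_class (f : {linear M -> N}) : stable_hom :=
  zquot_class null_pred (f : linhom M N).

Lemma stable_classP (f g : {linear M -> N}) :
  stable_class f = stable_class g <-> null_homotopic (f \- g).
Proof.
split=> [/zquot_classP/asboolP//|fg]; apply/zquot_classP; exact/asboolP.
Qed.

Definition stable_repr (f : stable_hom) : {linear M -> N} :=
  linfun_of (zquot_repr f).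

Lemma stable_reprK (f : stable_hom) : stable_class (stable_repr f) = f.
Proof. exact: zquot_reprK. Qed.

Lemma stable_classD (f g : {linear M -> N}) :
  stable_class (f \+ g) = stable_class f + stable_class g.
Proof. by rewrite -[RHS]zquot_classD; congr (zquot_class _ _); apply: linhom_ext. Qed.

Lemma eq_stable_class (f g : {linear M -> N}) :
  f =1 g -> stable_class f = stable_class g.
Proof. by move=> fg; congr (zquot_class _ _); apply: linhom_ext. Qed.

End NullHomotopic.

Definition stable_comp (M N P : lmodType A) (g : stable_hom N P)
    (f : stable_hom M N) : stable_hom M P :=
  stable_class (stable_repr g \o stable_repr f).

Lemma stable_comp_class (M N P : lmodType A) (g : {linear N -> P})
    (f : {linear M -> N}) :
  stable_comp (stable_class g) (stable_class f) = stable_class (g \o f).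
Proof.
have /stable_classP[Q [a [b ab]]] := stable_reprK (stable_class g).
have /stable_classP[Q' [a' [b' ab']]] := stable_reprK (stable_class f).
have n1 : null_homotopic ((stable_repr (stable_class g) \- g) \o
    stable_repr (stable_class f)).
  exists Q, (a \o stable_repr (stable_class f)), b => x; exact: ab.
have n2 : null_homotopic (g \o (stable_repr (stable_class f) \- f)).
  exists Q', a', (g \o b') => x /=; congr (g _); exact: ab'.
rewrite /stable_comp; move: n1 n2.
set g' := stable_repr (stable_class g); set f' := stable_repr (stable_class f).
move=> n1 n2.
transitivity (stable_class (g \o f')); apply/stable_classP.
  by case: n1 => [P1 [c [d E]]]; exists P1, c, d => x; rewrite -E.
case: n2 => [P1 [c [d E]]]; exists P1, c, d => x; rewrite -E /=.
by rewrite linearB.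
Qed.

Fact stable_compA (W X Y Z : lmodType A) (h : stable_hom Y Z)
    (g : stable_hom X Y) (f : stable_hom W X) :
  stable_comp h (stable_comp g f) = stable_comp (stable_comp h g) f.
Proof.
rewrite -(stable_reprK h) -(stable_reprK g) -(stable_reprK f).
by rewrite !stable_comp_class; apply: eq_stable_class.
Qed.
Fact stable_comp1m (X Y : lmodType A) (f : stable_hom X Y) :
  stable_comp (stable_class idfun) f = f.
Proof.
by rewrite -[in LHS](stable_reprK f) stable_comp_class -[RHS]stable_reprK;
   apply: eq_stable_class.
Qed.
Fact stable_compm1 (X Y : lmodType A) (f : stable_hom X Y) :
  stable_comp f (stable_class idfun) = f.
Proof.
by rewrite -[in LHS](stable_reprK f) stable_comp_class -[RHS]stable_reprK;
   apply: eq_stable_class.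
Qed.
Fact stable_compDl (X Y Z : lmodType A) (g g' : stable_hom Y Z)
    (f : stable_hom X Y) :
  stable_comp (g + g') f = stable_comp g f + stable_comp g' f.
Proof.
rewrite -(stable_reprK g) -(stable_reprK g') -(stable_reprK f).
rewrite -stable_classD !stable_comp_class -stable_classD.
exact: eq_stable_class.
Qed.
Fact stable_compDr (X Y Z : lmodType A) (g : stable_hom Y Z)
    (f f' : stable_hom X Y) :
  stable_comp g (f + f') = stable_comp g f + stable_comp g f'.
Proof.
rewrite -(stable_reprK g) -(stable_reprK f') -(stable_reprK f).
rewrite -stable_classD !stable_comp_class -stable_classD.
by apply: eq_stable_class => x /=; rewrite linearD.
Qed.

Definition stable_cat : preaddCat :=
  PreaddCat stable_compA stable_comp1m stable_compm1 stable_compDl stable_compDr.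

End StableCategory.

Section Shift.
Variables (k : fieldType) (H : hopfAlgType k) (Lam : H) (A : comodAlgType H).

(* [H / H Lam]; see [quot_integralP] for the equality [H Lam = k Lam]. *)
Definition quot_integral : lmodType H := quotmod (fun h : H^o => h = Lam).

Definition quot_integral_class : {linear H^o -> quot_integral} :=
  quot_class (fun h : H^o => h = Lam).

Lemma quot_integralP (h : H) : left_integral Lam ->
  quot_integral_class h = 0 <-> exists c : k, h = kscal c * Lam.
Proof.
move=> [_ intL].
rewrite -(linear0 quot_integral_class) /quot_integral_class /=.
rewrite quot_classP subr0; split.
  move: h; apply: (@span_ind _ H^o _ (fun h => exists c : k, h = kscal c * Lam))
    => [_ ->||_ _ [c ->] [d ->]|a _ [c ->]].
  - by exists 1; rewrite kscal1 mul1r.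
  - exists 0; have k0 : kscal 0 = 0 :> H.
      by apply: (addIr (kscal 0)); rewrite -kscalD !add0r.
    by rewrite k0 mul0r.
  - by exists (c + d); rewrite kscalD mulrDl.
  - exists (c * counit a).
    by rewrite -[LHS]/(a * _) mulrA -kscalC -mulrA intL mulrA kscalM.
move=> [c ->]; rewrite -[X in X \in _]/(kscal c *: (Lam : H^o)).
by rewrite rpredZ //; exact: mem_span.
Qed.

Definition shift_obj (M : lmodType A) : lmodType A := tensM quot_integral M.

Definition shift_map (M N : lmodType A) (f : {linear M -> N}) :
  {linear shift_obj M -> shift_obj N} := tensM_map idfun f.

(* The value on a stable morphism is computed on a chosen representative; that
   it does not depend on this choice is not part of the definition. *)
Definition stable_shift : endo (stable_cat A) :=
  Endo (C := stable_cat A) (fun (M N : lmodType A) (f : stable_hom M N) =>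
    stable_class (shift_map (stable_repr f))).

Definition shift_proj (M : lmodType A) : {linear tensM H^o M -> shift_obj M} :=
  tensM_map quot_integral_class idfun.

Section Integral.
Hypothesis intL : left_integral Lam.
Variable M : lmodType A.

Definition integral_tens (m : M) : tensM H^o M := tens_pure (Lam : H^o) m.

Fact integral_tens_linear : linear integral_tens.
Proof.
have D m n : integral_tens (m + n) = integral_tens m + integral_tens n.
  exact: pureDr.
move=> a m n; rewrite D; congr (_ + _).
have E (x : tensor (restr H^o) (restr A^o)) :
    tens_act x (integral_tens m) =
    integral_tens ((tlift (fun h b => counit h *: b) x : A) *: m).
  have b_bil : bilinear_for *:%R *:%R
      (fun (h : restr H^o) (b : restr A^o) => counit h *: b).
    split=> [b c x' y|h c b b'] /=; first by rewrite counit_linear scalerDl scalerA.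
    by rewrite scalerDr !scalerA mulrC.
  have z : integral_tens 0 = 0.
    by apply: (addIr (integral_tens 0)); rewrite -D !add0r.
  elim/tensor_ind: x => [h b|x y IHx IHy].
    rewrite tens_act_pure (tlift_pure b_bil).
    have -> : h *: (Lam : H^o) = counit h *: (Lam : restr H^o) by exact: intL.2.
    rewrite pureZl -pureZr; congr (pure _ _).
    by rewrite -[RHS]/((kscal (counit h) * (b : A)) *: m) -scalerA.
  rewrite tens_actDl IHx IHy -D; congr integral_tens.
  have := tlift_linear b_bil 1 x y; rewrite !scale1r => ->.
  by rewrite scalerDl.
by rewrite -[a in LHS]coact_counit -E.
Qed.
HB.instance Definition _ := GRing.isLinear.Build A M (tensM H^o M) *:%R
  integral_tens integral_tens_linear.

Definition integral_incl : {linear M -> tensM H^o M} := integral_tens.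
End Integral.

Definition is_pushout (R : pzRingType) (X P Y C : lmodType R)
    (x : {linear X -> P}) (u : {linear X -> Y})
    (v : {linear Y -> C}) (ubar : {linear P -> C}) : Prop :=
  ubar \o x =1 v \o u /\
  forall (D : lmodType R) (f : {linear P -> D}) (g : {linear Y -> D}),
    f \o x =1 g \o u ->
    exists h : {linear C -> D}, [/\ h \o ubar =1 f, h \o v =1 g &
      forall h' : {linear C -> D}, h' \o ubar =1 f -> h' \o v =1 g -> h' =1 h].

Definition standard_triangle (intL : left_integral Lam)
    (S : triangle stable_shift) : Prop :=
  exists (X Y C : lmodType A) (u : {linear X -> Y})
    (v : {linear Y -> C}) (ubar : {linear tensM H^o X -> C})
    (w : {linear C -> shift_obj X}),
    [/\ is_pushout (integral_incl intL X) u v ubar,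
      w \o ubar =1 shift_proj X, w \o v =1 \0
    & S = Triangle (T := stable_shift) (trX := X) (trY := Y) (trZ := C)
        (stable_class u) (stable_class v) (stable_class w)].

Definition distinguished (intL : left_integral Lam)
    (S : triangle stable_shift) : Prop :=
  exists S', standard_triangle intL S' /\ triangle_iso S S'.

End Shift.

(* Main.v *)
Require Import Defs.
From mathcomp Require Import all_boot all_algebra.
From HB Require Import structures.
From mathcomp Require Import boolp.

Set Implicit Arguments.
Unset Strict Implicit.
Unset Printing Implicit Defensive.

Import GRing.Theory Defs.
Local Open Scope ring_scope.

(** Why the theorem holds.  For an [A]-module [M] put [I M = H ⊗ M], with
    [iota : M -> I M], [m ↦ Lam ⊗ m], and its cokernel [pi : I M -> T M].  The
    statement is Happel's theorem that the stable category of a Frobenius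
    category is triangulated, where the [I M] are both the relative injectives
    and the relative projectives.  Two facts make them so.

    Injectivity ([free_extension]): every map [M -> I N] extends along
    [iota : M -> I M].  It suffices to extend the identity of [I N], that is, to
    give a map [H ⊗ (H ⊗ N) -> H ⊗ N] with [Lam ⊗ l ⊗ n ↦ l ⊗ n]; the map
    [h ⊗ l ⊗ n ↦ g(h, l_1) l_2 ⊗ n] will do when [g : H ⊗ H -> k] is [H]-linear
    and [g(Lam, l) = eps(l)].  Such a pairing is [g(h, l) = f(S^-1(l) h)], where
    [f] is a linear form with [f(Lam) = 1]; this is the only place where [S]
    has to be invertible.  That it is follows from the identity
    [Lam_1 ⊗ x Lam_2 = S(x) Lam_1 ⊗ Lam_2] ([integral_comul_shift],
    [antipode_injective]).  As a consequence a map is null-homotopic if and only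
    if it extends along [iota] ([null_homotopicP]).

    Projectivity ([free_lift_shift]): every map [I N -> T Y] lifts along [pi].
    This uses the comultiplication [I N -> I (I N)] and the mirror pairing
    [f(S(h) l)], whose value at [l = Lam] is [eps(h)].

    From these, [T] is fully faithful on the stable category: maps between
    cokernels are compared with maps between the middle terms of
    [X -> I X -> T X].  It is essentially surjective because [T] sends
    [Ker eps ⊗ M] to an object stably isomorphic to [M] ([syzygy]).

    The cone of [u : X -> Y] is [I X ⊕ Y] modulo [(Lam ⊗ x, - u x)], and all the
    maps required by the axioms can be written down on [I X] and [Y]: the filling
    of a square, the equivalence [T X -> C_v] behind rotation, and for the
    octahedron the equivalence [C_v -> C_f], where [f : C_u -> C_(v u)].  What
    remains is formal ([triangulated_of_standard]): cones are unique because a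
    self-map [h] of a cone that is compatible with the identities of the other
    two vertices has [(h - 1)^2 = 0], so the axioms pass from standard to
    distinguished triangles, and a triangle can be rotated back by rotating it
    forward twice more and using that [T] is fully faithful. *)

(** * Linear maps and sums over tensors *)

Section LinearFacts.
Variables (R : pzRingType) (U V : lmodType R) (f : U -> V).
Hypothesis fl : linear f.
Lemma linear_morphD x y : f (x + y) = f x + f y.
Proof. by have := fl 1 x y; rewrite !scale1r. Qed.
Lemma linear_morph0 : f 0 = 0.
Proof. by apply: (addIr (f 0)); rewrite -linear_morphD !add0r. Qed.
Lemma linear_morphZ a x : f (a *: x) = a *: f x.
Proof. by have := fl a x 0; rewrite !addr0 linear_morph0 addr0. Qed.
Lemma linear_morphB x y : f (x - y) = f x - f y.
Proof. by rewrite -scaleN1r linear_morphD linear_morphZ scaleN1r. Qed.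
Lemma linear_morph_sum (I : Type) (r : seq I) (E : I -> U) :
  f (\sum_(i <- r) E i) = \sum_(i <- r) f (E i).
Proof. exact: (big_morph f linear_morphD linear_morph0). Qed.
End LinearFacts.

Section TensorSums.
Variables (k : fieldType) (U V : lmodType k).

Lemma tensor_sum (t : tensor U V) :
  {s : seq (U * V) | t = \sum_(p <- s) pure p.1 p.2}.
Proof.
apply: cid; elim/tensor_ind: t => [u v|s t [s' ->] [t' ->]].
  by exists [:: (u, v)]; rewrite big_seq1.
by exists (s' ++ t'); rewrite big_cat.
Qed.

(** Sweedler notation: [tsum (comul h) (fun a b => F a b)] is the sum written
    [F(h_1, h_2)].  It is taken over a chosen presentation of the tensor, so that
    sums can be exchanged and linear maps pulled through without conditions on
    [F]; bilinearity is needed only where the choice has to be irrelevant. *)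
Definition tsum (W : zmodType) (t : tensor U V) (F : U -> V -> W) : W :=
  \sum_(p <- sval (tensor_sum t)) F p.1 p.2.

Lemma tensor_tsum t : t = tsum t (fun u v => pure u v).
Proof. exact: (svalP (tensor_sum t)). Qed.

Lemma eq_tsum (W : zmodType) t (F G : U -> V -> W) :
  (forall u v, F u v = G u v) -> tsum t F = tsum t G.
Proof. by move=> FG; apply: eq_bigr => p _. Qed.

Lemma linear_tsum (W : lmodType k) (f : tensor U V -> W) t :
  linear f -> f t = tsum t (fun u v => f (pure u v)).
Proof. by move=> fl; rewrite {1}(tensor_tsum t) (linear_morph_sum fl). Qed.

Lemma tlift_tsum (W : lmodType k) t (F : U -> V -> W) :
  bilinear_for *:%R *:%R F -> tlift F t = tsum t F.
Proof.
move=> Fb; rewrite (linear_tsum t (tlift_linear Fb)).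
by apply: eq_tsum => u v; rewrite tlift_pure.
Qed.

Lemma tsum_pure (W : lmodType k) u v (F : U -> V -> W) :
  bilinear_for *:%R *:%R F -> tsum (pure u v) F = F u v.
Proof. by move=> Fb; rewrite -tlift_tsum // tlift_pure. Qed.

Lemma tsum_linear (W : lmodType k) (F : U -> V -> W) :
  bilinear_for *:%R *:%R F -> linear (fun t => tsum t F).
Proof. by move=> Fb a s t; rewrite -!tlift_tsum // (tlift_linear Fb). Qed.

Lemma tsum_morph (W W' : zmodType) (f : W -> W') t (F : U -> V -> W) :
  f 0 = 0 -> {morph f : x y / x + y} ->
  f (tsum t F) = tsum t (fun u v => f (F u v)).
Proof. by move=> f0 fD; rewrite /tsum; exact: big_morph. Qed.

Lemma linear_of_tsum (W W' : lmodType k) (f : W -> W') t (F : U -> V -> W) :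
  linear f -> f (tsum t F) = tsum t (fun u v => f (F u v)).
Proof.
by move=> fl; apply: tsum_morph; [exact: linear_morph0|exact: linear_morphD].
Qed.

End TensorSums.

Lemma exchange_tsum (k : fieldType) (U V U' V' : lmodType k) (W : zmodType)
    (t : tensor U V) (t' : tensor U' V') (F : U -> V -> U' -> V' -> W) :
  tsum t (fun u v => tsum t' (F u v)) =
  tsum t' (fun u' v' => tsum t (fun u v => F u v u' v')).
Proof. exact: exchange_big. Qed.

Section Coassoc.
Variables (k : fieldType) (C B : lmodType k).
Variables (cop : C -> tensor C C) (coa : B -> tensor C B).
Hypotheses (copl : linear cop) (coal : linear coa).

(** Both sides are values of the linear map induced by [F] on the two sides of
    the coassociativity law.  With [B] kept apart from [C] it covers at once the
    comultiplication of a coalgebra and the coaction of a comodule. *)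
Lemma tsum_coassoc (W : lmodType k) (F : C -> C -> B -> W) b :
  (forall c, bilinear_for *:%R *:%R (fun x y => F x y c)) ->
  (forall x y, linear (F x y)) ->
  tassoc (tmap id coa (coa b)) = tmap cop id (coa b) ->
  tsum (coa b) (fun x c => tsum (cop x) (fun y z => F y z c)) =
  tsum (coa b) (fun x c => tsum (coa c) (fun y d => F x y d)).
Proof.
move=> F12 F3 E.
have Pb : bilinear_for *:%R *:%R (fun t c => tlift (fun x y => F x y c) t).
  split=> [c a s t|t a c d] /=; first exact: (tlift_linear (F12 c)).
  rewrite !tlift_tsum // /tsum scaler_sumr -big_split /=.
  by apply: eq_bigr => p _; rewrite F3.
have idl (X : lmodType k) : linear (id : X -> X) by [].
have pb (u : C) : linear (pure u : C -> tensor C C).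
  by move=> a x y; rewrite pureDr pureZr.
have tb : bilinear_for *:%R *:%R
    (fun (u : C) (t : tensor C B) => tmap (pure u) id t).
  split=> [t a x y|u a s t] /=; last exact: (tmap_linear (pb u) (idl B)).
  move: t; apply: (tensor_eq_lin (f := tmap (pure (a *: x + y)) id)
      (g := fun t => a *: tmap (pure x) id t + tmap (pure y) id t)).
  - exact: (tmap_linear (pb _) (idl B)).
  - move=> c s t; rewrite !(tmap_linear (pb _) (idl B)) !scalerDr !scalerA.
    by rewrite (mulrC c) addrACA.
  - by move=> u v; rewrite !(tmap_pure (pb _) (idl B)) pureDl pureZl pureDl pureZl.
transitivity (tlift (fun t c => tlift (fun x y => F x y c) t)
    (tmap cop id (coa b))).
  rewrite [in RHS](tensor_tsum (coa b)) /tsum.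
  rewrite (linear_morph_sum (tmap_linear copl (idl B))).
  rewrite (linear_morph_sum (tlift_linear Pb)); apply: eq_bigr => p _.
  by rewrite (tmap_pure copl (idl B)) tlift_pure // tlift_tsum.
rewrite -E [in LHS](tensor_tsum (coa b)) /tsum.
rewrite (linear_morph_sum (tmap_linear (idl C) coal)).
rewrite /tassoc (linear_morph_sum (tlift_linear tb)).
rewrite (linear_morph_sum (tlift_linear Pb)); apply: eq_bigr => p _.
rewrite (tmap_pure (idl C) coal) tlift_pure //.
rewrite [in LHS](tensor_tsum (coa p.2)) /tsum.
rewrite (linear_morph_sum (tmap_linear (pb _) (idl B))).
rewrite (linear_morph_sum (tlift_linear Pb)); apply: eq_bigr => q _.
by rewrite (tmap_pure (pb _) (idl B)) !tlift_pure.
Qed.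
End Coassoc.

(** * Hopf algebra identities *)

Section LinearCombinators.
Variables (k : fieldType) (U V W X : lmodType k).

Lemma linear_id : linear (fun x : U => x). Proof. by []. Qed.
Lemma linear_compose (f : V -> W) (g : U -> V) :
  linear f -> linear g -> linear (fun x => f (g x)).
Proof. by move=> fl gl a x y; rewrite gl fl. Qed.
Lemma linear_scale_right c (g : U -> V) :
  linear g -> linear (fun x => c *: g x).
Proof. by move=> gl a x y; rewrite gl scalerDr !scalerA mulrC. Qed.
Lemma linear_scale_left (e : V -> k) (g : U -> V) (w : W) :
  scalar e -> linear g -> linear (fun x => e (g x) *: w).
Proof. by move=> el gl a x y; rewrite gl el scalerDl scalerA. Qed.
Lemma linear_tsum_right (t : tensor V W) (F : U -> V -> W -> X) :
  (forall v w, linear (fun x => F x v w)) -> linear (fun x => tsum t (F x)).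
Proof.
move=> Fl a x y; rewrite /tsum scaler_sumr -big_split /=.
by apply: eq_bigr => p _; exact: Fl.
Qed.
Lemma linear_tsum_left (g : U -> tensor V W) (F : V -> W -> X) :
  (forall w, linear (F^~ w)) -> (forall v, linear (F v)) -> linear g ->
  linear (fun x => tsum (g x) F).
Proof. by move=> F1 F2 gl a x y; rewrite gl (tsum_linear (conj F1 F2)). Qed.
End LinearCombinators.

(** The product of [H] on the underlying vector space.  It is locked because
    unification would otherwise take the scalar multiplication of [restr H^o],
    which is a product with a scalar of [H], for an instance of it. *)
HB.lock Definition hmul (k : fieldType) (H : hopfAlgType k) (x y : restr H^o) :
  restr H^o := (x : H) * (y : H).

Section HopfLinearity.
Variables (k : fieldType) (H : hopfAlgType k).
Local Notation Hk := (restr H^o).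

Local Notation "x ⋅ y" := (@hmul k H x y) (at level 40, left associativity).
Local Notation S := (@antipode k H).
Local Notation e := (@counit k H).
Local Notation D := (@comul k H).
Local Notation h1 := (1 : H).

Lemma hmulE (x y : Hk) : x ⋅ y = (x : H) * (y : H).
Proof. by rewrite hmul.unlock. Qed.

Lemma hmulA (x y z : Hk) : x ⋅ (y ⋅ z) = x ⋅ y ⋅ z.
Proof. rewrite !hmulE; exact: (@mulrA H). Qed.
Lemma hmul1l (x : Hk) : h1 ⋅ x = x. Proof. rewrite !hmulE; exact: (@mul1r H). Qed.
Lemma hmul1r (x : Hk) : x ⋅ h1 = x. Proof. rewrite !hmulE; exact: (@mulr1 H). Qed.
Lemma hmulZl c (x y : Hk) : (c *: x) ⋅ y = c *: (x ⋅ y).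
Proof. rewrite !hmulE; exact/esym/(@mulrA H). Qed.
Lemma hmulZr c (x y : Hk) : x ⋅ (c *: y) = c *: (x ⋅ y).
Proof.
rewrite !hmulE -[c *: y]/((kscal c : H) * (y : H)).
by rewrite -[RHS]/((kscal c : H) * ((x : H) * (y : H))) !mulrA kscalC.
Qed.
Lemma hmulDl (x x' y : Hk) : (x + x') ⋅ y = x ⋅ y + x' ⋅ y.
Proof. rewrite !hmulE; exact: (@mulrDl H). Qed.
Lemma hmulDr (x y y' : Hk) : x ⋅ (y + y') = x ⋅ y + x ⋅ y'.
Proof. rewrite !hmulE; exact: (@mulrDr H). Qed.

Lemma hmul_linearl (U : lmodType k) (g : U -> Hk) b :
  linear g -> linear (fun x => g x ⋅ b).
Proof. by move=> gl a x y; rewrite gl hmulDl hmulZl. Qed.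
Lemma hmul_linearr (U : lmodType k) (g : U -> Hk) b :
  linear g -> linear (fun x => b ⋅ g x).
Proof. by move=> gl a x y; rewrite gl hmulDr hmulZr. Qed.
Lemma antipode_linear_comp (U : lmodType k) (g : U -> Hk) :
  linear g -> linear (fun x => S (g x)).
Proof. by move=> gl a x y; rewrite gl antipode_linear. Qed.
Lemma comul_linear_comp (U : lmodType k) (g : U -> Hk) :
  linear g -> linear (fun x => D (g x)).
Proof. by move=> gl a x y; rewrite gl comul_linear. Qed.
Lemma counit_linear_comp (U W : lmodType k) (g : U -> Hk) (w : W) :
  linear g -> linear (fun x => e (g x) *: w).
Proof. exact: linear_scale_left counit_linear. Qed.

End HopfLinearity.

Ltac lin := cbv beta; repeat first
  [ assumption | exact: linear_id | apply: hmul_linearl | apply: hmul_linearr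
  | apply: antipode_linear_comp | apply: comul_linear_comp
  | apply: counit_linear_comp | apply: linear_scale_right
  | match goal with Fb : bilinear_for _ _ ?F |- linear (fun x => ?F _ ?b) =>
      apply: (linear_compose (Fb.1 b)) end
  | match goal with Fb : bilinear_for _ _ ?F |- linear (fun x => ?F ?a _) =>
      apply: (linear_compose (Fb.2 a)) end
  | apply: linear_tsum_right => ? ? | apply: linear_tsum_left => [?|?|] ].
Ltac bil := split => ? /=; lin.

Section Hopf.
Variables (k : fieldType) (H : hopfAlgType k).
Local Notation Hk := (restr H^o).
Local Notation "x ⋅ y" := (@hmul k H x y) (at level 40, left associativity).
Local Notation S := (@antipode k H).
Local Notation e := (@counit k H).
Local Notation D := (@comul k H).
Local Notation h1 := (1 : H).

Lemma comulM_tsum (W : lmodType k) (F : Hk -> Hk -> W) x y :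
  bilinear_for *:%R *:%R F ->
  tsum (D (x ⋅ y)) F =
  tsum (D x) (fun a b => tsum (D y) (fun c d => F (a ⋅ c) (b ⋅ d))).
Proof.
move=> Fb; rewrite hmulE comulM /tmul.
rewrite (linear_tsum (D x) (tens_act_linearl _)).
rewrite (linear_of_tsum _ _ (tsum_linear Fb)); apply: eq_tsum => a b.
rewrite (linear_tsum (D y) (tens_act_linearr _)).
rewrite (linear_of_tsum _ _ (tsum_linear Fb)); apply: eq_tsum => c d.
by rewrite (tens_act_pure a b (c : H^o) (d : H^o)) tsum_pure // !hmulE.
Qed.

Lemma counitl_tsum (W : lmodType k) (F : Hk -> W) h : linear F ->
  tsum (D h) (fun x y => e x *: F y) = F h.
Proof.
move=> Fl; have b : bilinear_for *:%R *:%R (fun x y : Hk => e x *: y) by bil.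
rewrite -[in RHS](counitl h) (tlift_tsum _ b) (linear_of_tsum _ _ Fl).
by apply: eq_tsum => x y; rewrite (linear_morphZ Fl).
Qed.

Lemma counitr_tsum (W : lmodType k) (F : Hk -> W) h : linear F ->
  tsum (D h) (fun x y => e y *: F x) = F h.
Proof.
move=> Fl; have b : bilinear_for *:%R *:%R (fun x y : Hk => e y *: x) by bil.
rewrite -[in RHS](counitr h) (tlift_tsum _ b) (linear_of_tsum _ _ Fl).
by apply: eq_tsum => x y; rewrite (linear_morphZ Fl).
Qed.

Lemma antipodel_tsum h : tsum (D h) (fun x y => S x ⋅ y) = e h *: (h1 : Hk).
Proof.
have b : bilinear_for *:%R *:%R (fun x y : Hk => S x ⋅ y) by bil.
by move: b; rewrite hmul.unlock => b; rewrite -antipodel tlift_tsum.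
Qed.
Lemma antipoder_tsum h : tsum (D h) (fun x y => x ⋅ S y) = e h *: (h1 : Hk).
Proof.
have b : bilinear_for *:%R *:%R (fun x y : Hk => x ⋅ S y) by bil.
by move: b; rewrite hmul.unlock => b; rewrite -antipoder tlift_tsum.
Qed.

Lemma comulA_tsum (W : lmodType k) (F : Hk -> Hk -> Hk -> W) h :
  (forall y z, linear (fun x => F x y z)) ->
  (forall x z, linear (fun y => F x y z)) ->
  (forall x y, linear (F x y)) ->
  tsum (D h) (fun x c => tsum (D x) (fun y z => F y z c)) =
  tsum (D h) (fun x c => tsum (D c) (fun y d => F x y d)).
Proof.
move=> F1 F2 F3; apply: tsum_coassoc => //; try exact: comul_linear.
- by move=> c; split => ?; [exact: F1|exact: F2].
- exact: comulA.
Qed.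

Lemma hmul_tsuml (U V : lmodType k) (t : tensor U V)
    (F : U -> V -> Hk) (b : Hk) :
  tsum t F ⋅ b = tsum t (fun u v => F u v ⋅ b).
Proof. by apply: (linear_of_tsum (f := fun x => x ⋅ b)); lin. Qed.
Lemma hmul_tsumr (U V : lmodType k) (t : tensor U V)
    (F : U -> V -> Hk) (b : Hk) :
  b ⋅ tsum t F = tsum t (fun u v => b ⋅ F u v).
Proof. by apply: (linear_of_tsum (f := fun x => b ⋅ x)); lin. Qed.

(** Expand [S h] to [eps(h_1) S(h_2)] and [eps(x) eps(h_1)] to
    [S(x_1 h_1) x_2 h_2]; the remaining [h_2 S(h_3)] cancels.  This is the
    [H]-linearity of [S(h) l] in [h ⊗ l], and antimultiplicativity of [S] follows
    from it. *)
Lemma antipode_cancel x h :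
  tsum (D x) (fun x1 x2 => S (x1 ⋅ h) ⋅ x2) = e x *: S h.
Proof.
transitivity (tsum (D h) (fun a b => tsum (D (x ⋅ a)) (fun c d => S c ⋅ d ⋅ S b))).
  transitivity (tsum (D h) (fun a b => tsum (D a) (fun c d =>
      tsum (D x) (fun x1 x2 => S (x1 ⋅ c) ⋅ (x2 ⋅ d) ⋅ S b)))); last first.
    apply: eq_tsum => a b; rewrite comulM_tsum; last by bil.
    exact: exchange_tsum.
  rewrite (comulA_tsum (F := fun c d b => tsum (D x) (fun x1 x2 =>
      S (x1 ⋅ c) ⋅ (x2 ⋅ d) ⋅ S b))); [|by move=> *; lin..].
  transitivity (tsum (D h) (fun a b => e b *: tsum (D x) (fun x1 x2 => S (x1 ⋅ a) ⋅ x2))).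
    by rewrite counitr_tsum //; lin.
  apply: eq_tsum => a b; rewrite exchange_tsum linear_of_tsum; last first.
    by apply: linear_scale_right; exact: linear_id.
  apply: eq_tsum => x1 x2.
  rewrite -[in LHS](hmul1r x2) -hmulZr -hmulZr -antipoder_tsum !hmul_tsumr.
  by apply: eq_tsum => c d; rewrite !hmulA.
rewrite -[S h](counitl_tsum (F := S) h (@antipode_linear k H)).
rewrite [RHS]linear_of_tsum; last by apply: linear_scale_right; exact: linear_id.
apply: eq_tsum => a b; rewrite -hmul_tsuml antipodel_tsum hmulZl hmul1l.
by rewrite hmulE counitM scalerA.
Qed.

Lemma antipodeM x h : S (x ⋅ h) = S h ⋅ S x.
Proof.
transitivity (tsum (D x) (fun a b => e b *: S (a ⋅ h))).
  by rewrite counitr_tsum //; lin.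
transitivity (tsum (D x) (fun a b => tsum (D b) (fun c d => S (a ⋅ h) ⋅ c ⋅ S d))).
  apply: eq_tsum => a b; rewrite -[S (a ⋅ h)]hmul1r -hmulZr -antipoder_tsum.
  by rewrite hmul_tsumr; apply: eq_tsum => c d; rewrite hmul1r hmulA.
rewrite -(comulA_tsum (F := fun a c d => S (a ⋅ h) ⋅ c ⋅ S d)); [|by move=> *; lin..].
transitivity (tsum (D x) (fun a b => e a *: (S h ⋅ S b))).
  by apply: eq_tsum => a b; rewrite -hmul_tsuml antipode_cancel hmulZl.
by rewrite counitl_tsum //; lin.
Qed.

Lemma counit_antipode h : e (S h) = e h.
Proof.
have el : linear (e : Hk -> k^o) by exact: counit_linear.
transitivity (tsum (D h) (fun a b => e b *: (e (S a) : k^o))).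
  by rewrite (counitr_tsum (F := fun a => e (S a) : k^o)) //;
    apply: linear_compose el antipode_linear.
have := congr1 e (antipodel_tsum h).
rewrite (linear_of_tsum _ _ el) -[RHS]/(e (e h *: _)) (linear_morphZ el) counit1.
rewrite -[e h *: _]/(e h * 1) mulr1 => <-; apply: eq_tsum => a b.
by rewrite hmulE counitM mulrC.
Qed.

End Hopf.

(** * The integral and invariant pairings *)

Section FiniteDimension.
Variables (k : fieldType) (V : lmodType k).
Hypothesis fdV : finite_dimensional V.

Lemma finite_dimensional_coordinates :
  exists (n : nat) (f : V -> 'rV[k]_n) (E : 'I_n -> V),
    linear f /\ forall v, v = \sum_i f v 0 i *: E i.
Proof.
have [n [f [fl [g fK gK]]]] := fdV.
have gl : linear g by move=> a x y; apply: (can_inj fK); rewrite fl !gK.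
exists n, f, (fun i => g (delta_mx 0 i)); split=> // v.
rewrite -{1}(fK v) {1}(row_sum_delta (f v)) (linear_morph_sum gl).
by apply: eq_bigr => i _; rewrite (linear_morphZ gl).
Qed.

Lemma finite_dimensional_functional v : v != 0 ->
  exists l : V -> k, scalar l /\ l v = 1.
Proof.
move=> v0; have [n [f [E [fl fE]]]] := finite_dimensional_coordinates.
have [/forallP f0|/forallPn[i fi]] := boolP [forall i, f v 0 i == 0].
  case/eqP: v0; rewrite (fE v) big1 // => i _.
  by rewrite (eqP (f0 i)) scale0r.
exists (fun w => (f v 0 i)^-1 * f w 0 i); split; last by rewrite mulVf.
by move=> a x y; rewrite fl !mxE mulrDr mulrCA.
Qed.

Lemma finite_dimensional_injective (s : V -> V) :
  linear s -> (forall v, s v = 0 -> v = 0) ->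
  exists t : V -> V, [/\ linear t, cancel s t & cancel t s].
Proof.
move=> sl s0; have [n [f [fl [g fK gK]]]] := fdV.
have gl : linear g by move=> a x y; apply: (can_inj fK); rewrite fl !gK.
have pl : linear (fun x => f (s (g x))) by move=> a x y; rewrite gl sl fl.
pose p : {linear 'rV[k]_n -> 'rV[k]_n} :=
  HB.pack (fun x => f (s (g x))) (GRing.isLinear.Build _ _ _ _ _ pl).
have pE x : x *m lin1_mx p = f (s (g x)) by rewrite mul_rV_lin1.
have pu : lin1_mx p \in unitmx.
  rewrite -row_free_unit -kermx_eq0; apply/eqP/row_matrixP => i.
  rewrite row0; set x := row i _.
  have xp : x *m lin1_mx p = 0 by rewrite -row_mul mulmx_ker row0.
  have sx : s (g x) = 0.
    by rewrite -(fK (s (g x))) -pE xp (linear_morph0 gl).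
  by rewrite -(gK x) (s0 _ sx) (linear_morph0 fl).
exists (fun v => g (f v *m invmx (lin1_mx p))); split.
- by move=> a x y; rewrite fl mulmxDl -scalemxAl gl.
- move=> v; have -> : f (s v) = f v *m lin1_mx p by rewrite pE fK.
  by rewrite mulmxK // fK.
- move=> v; set x := _ *m _; apply: (can_inj fK).
  by rewrite -pE /x mulmxKV.
Qed.
End FiniteDimension.

Section Pairings.
Variables (k : fieldType) (H : hopfAlgType k).
Local Notation Hk := (restr H^o).
Local Notation "x ⋅ y" := (@hmul k H x y) (at level 40, left associativity).
Local Notation S := (@antipode k H).
Local Notation e := (@counit k H).
Local Notation D := (@comul k H).

(** An [H]-linear map from [H ⊗ H] to the trivial module [k]. *)
Definition invariant_pairing (g : Hk -> Hk -> k^o) : Prop :=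
  bilinear_for *:%R *:%R g /\
  forall x h l, tsum (D x) (fun a b => g (a ⋅ h) (b ⋅ l)) = e x *: g h l.

Variable Lam : H.
Hypotheses (intL : left_integral Lam) (fdH : finite_dimensional Hk).

Lemma hmul_integral x : x ⋅ Lam = e x *: (Lam : Hk).
Proof. by rewrite hmulE intL.2. Qed.

(** [S(x_1) x_2 Lam_1 ⊗ x_3 Lam_2] is [Lam_1 ⊗ x Lam_2] by the antipode law, and
    [S(x) Lam_1 ⊗ Lam_2] because [x_2 Lam_1 ⊗ x_3 Lam_2] is
    [comul (x_2 Lam) = eps(x_2) comul Lam]. *)
Lemma integral_comul_shift (W : lmodType k) (F : Hk -> Hk -> W) x :
  bilinear_for *:%R *:%R F ->
  tsum (D Lam) (fun a b => F a (x ⋅ b)) = tsum (D Lam) (fun a b => F (S x ⋅ a) b).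
Proof.
move=> Fb.
transitivity (tsum (D x) (fun y z => e y *: tsum (D Lam) (fun a b => F a (z ⋅ b)))).
  by rewrite counitl_tsum //; lin.
transitivity (tsum (D x) (fun y z => tsum (D y) (fun c d =>
    tsum (D Lam) (fun a b => F (S c ⋅ (d ⋅ a)) (z ⋅ b))))).
  apply: eq_tsum => y z; rewrite exchange_tsum linear_of_tsum; last first.
    by apply: linear_scale_right; exact: linear_id.
  apply: eq_tsum => a b.
  rewrite -[e y *: _](linear_morphZ (Fb.1 (z ⋅ b))) -[a in LHS]hmul1l -hmulZl.
  rewrite -antipodel_tsum hmul_tsuml (linear_of_tsum _ _ (Fb.1 _)).
  by apply: eq_tsum => c d; rewrite hmulA.
rewrite (comulA_tsum (F := fun c d z => tsum (D Lam) (fun a b =>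
    F (S c ⋅ (d ⋅ a)) (z ⋅ b)))); [|by move=> *; lin..].
transitivity (tsum (D x) (fun y z => e z *: tsum (D Lam) (fun a b => F (S y ⋅ a) b))).
  apply: eq_tsum => y z.
  have Gb : bilinear_for *:%R *:%R (fun a b => F (S y ⋅ a) b) by bil.
  rewrite -(comulM_tsum _ _ Gb) hmul_integral (linear_morphZ (@comul_linear k H)).
  by rewrite (linear_morphZ (tsum_linear Gb)).
by rewrite counitr_tsum //; lin.
Qed.

(** If [S h = 0] then [Lam_1 ⊗ h Lam_2 = 0] by [integral_comul_shift], so [h c = 0]
    for every right coefficient [c] of [comul Lam]; and also [(h y) c = 0] for
    all [y], because [S (h y) = S y S h = 0].  But
    [1 = l(Lam_1) S(Lam_2) Lam_3] for a linear form with [l(Lam) = 1], which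
    writes [h] as a sum of terms [(h y) c]. *)
Lemma antipode_injective h : S h = 0 -> h = 0.
Proof.
move=> Sh; have [l [ll lL]] := finite_dimensional_functional fdH intL.1.
have [n [f [E [fl fE]]]] := finite_dimensional_coordinates fdH.
pose t (x : Hk) : Hk := tsum (D x) (fun a b => l a *: S b).
have tl : linear t.
  apply: linear_tsum_left => [w|v|]; last exact: comul_linear.
    by apply: linear_scale_left ll (@linear_id _ _).
  by lin.
(* The element [1 = l(Lam_1) S(Lam_2) Lam_3]. *)
have t1 : tsum (D Lam) (fun a b => t a ⋅ b) = (1 : H).
  transitivity (tsum (D Lam) (fun a b => tsum (D a) (fun c d => (l c *: S d) ⋅ b))).
    by apply: eq_tsum => a b; rewrite hmul_tsuml.
  rewrite (comulA_tsum (F := fun c d b => (l c *: S d) ⋅ b)); last first.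
  - by move=> *; lin.
  - by move=> *; lin.
  - move=> y z; apply: hmul_linearl.
    exact: (linear_scale_left _ ll (@linear_id _ _)).
  transitivity (tsum (D Lam) (fun a b => e b *: (l a *: ((1 : H) : Hk)))).
    apply: eq_tsum => a b; rewrite scalerA mulrC -scalerA -antipodel_tsum.
    rewrite linear_of_tsum; last by apply: linear_scale_right; exact: linear_id.
    by apply: eq_tsum => c d; rewrite hmulZl.
  rewrite (counitr_tsum (F := fun a => l a *: ((1 : H) : Hk))) ?lL ?scale1r //.
  exact: (linear_scale_left _ ll (@linear_id _ _)).
rewrite -(hmul1r h) -t1 hmul_tsumr.
(* Coordinates detach the factor [S(Lam_2)] from the sum over [comul Lam]. *)
transitivity (\sum_i tsum (D Lam) (fun a b => f (t a) 0 i *: (h ⋅ E i ⋅ b))).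
  rewrite [RHS]exchange_big /=; apply: eq_bigr => p _.
  rewrite {1}(fE (t p.1)) hmulA.
  rewrite (linear_morph_sum (f := fun x => h ⋅ x)); last by lin.
  rewrite (linear_morph_sum (f := fun x => x ⋅ p.2)); last by lin.
  by apply: eq_bigr => i _; rewrite hmulZr hmulZl.
rewrite big1 // => i _.
rewrite (integral_comul_shift (F := fun a b => f (t a) 0 i *: b)); last first.
  split=> [b|a] /=; last by lin.
  apply: (linear_scale_left (e := fun x => f (t x) 0 i)) (@linear_id _ _) => a x y.
  by rewrite tl fl !mxE.
rewrite antipodeM Sh /tsum big1 // => p _.
rewrite [_ ⋅ 0](linear_morph0 (f := fun x => _ ⋅ x)); last by lin.
rewrite [0 ⋅ _](linear_morph0 (f := fun x => x ⋅ _)); last by lin.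
by rewrite (linear_morph0 tl) (linear_morph0 fl) mxE scale0r.
Qed.

(** [g(h, x) = l(S(h) x)] with [l(Lam) = 1]: at [x = Lam] the integral turns
    [S(h)] into [eps(S h) = eps h]. *)
Lemma right_integral_pairing :
  exists g, invariant_pairing g /\ forall h, g h Lam = e h.
Proof.
have [l [ll lL]] := finite_dimensional_functional fdH intL.1.
have ll' : linear (l : Hk -> k^o) by exact: ll.
exists (fun h x => l (S h ⋅ x)); split; last first.
  move=> h; rewrite hmul_integral counit_antipode.
  by rewrite (linear_morphZ ll') lL -[RHS]mulr1.
split.
  by split=> [x|h] /=; apply: (linear_compose ll'); lin.
move=> x h y; rewrite -(linear_morphZ ll') -hmulZl -antipode_cancel hmul_tsuml.
rewrite (linear_of_tsum _ _ ll'); apply: eq_tsum => a b.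
by rewrite hmulA.
Qed.

(** [g(h, x) = l(S^-1(x) h)] with [l(Lam) = 1].  Its invariance is that of
    [right_integral_pairing] after applying the injective map [S]. *)
Lemma left_integral_pairing :
  exists g, invariant_pairing g /\ forall h, g Lam h = e h.
Proof.
have [l [ll lL]] := finite_dimensional_functional fdH intL.1.
have ll' : linear (l : Hk -> k^o) by exact: ll.
have [T [Tl ST TS]] := finite_dimensional_injective fdH (@antipode_linear k H)
  antipode_injective.
have Tc (U : lmodType k) (f : U -> Hk) : linear f -> linear (fun x => T (f x)).
  by move=> fl a x y; rewrite fl Tl.
exists (fun h x => l (T x ⋅ h)); split; last first.
  move=> h; rewrite hmul_integral -(counit_antipode (T h)) TS.
  by rewrite (linear_morphZ ll') lL -[RHS]mulr1.
split.
  split=> [x|h] /=; apply: (linear_compose ll'); first by lin.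
  by apply: hmul_linearl; apply: Tc; lin.
move=> x h y; rewrite -(linear_morphZ ll') -hmulZl -(linear_of_tsum _ _ ll').
congr (l _); apply: (can_inj ST).
rewrite (linear_of_tsum _ _ (@antipode_linear k H)) hmulZl.
rewrite (linear_morphZ (@antipode_linear k H)) antipodeM TS.
transitivity (tsum (D x) (fun a b => S h ⋅ (S a ⋅ b) ⋅ y)).
  by apply: eq_tsum => a b; rewrite !antipodeM TS !hmulA.
rewrite -hmul_tsuml -hmul_tsumr antipodel_tsum hmulZr hmul1r hmulZl //.
Qed.

End Pairings.

(** * Maps out of the modules V ⊗ M *)

Lemma linear_descent (R : pzRingType) (P Q E : lmodType R)
    (p : {linear P -> Q}) (f : {linear P -> E}) :
  (forall y, exists x, p x = y) -> (forall x, p x = 0 -> f x = 0) ->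
  exists f' : {linear Q -> E}, forall x, f' (p x) = f x.
Proof.
move=> psurj pf; pose s y := sval (cid (psurj y)).
have sK y : p (s y) = y by exact: svalP (cid (psurj y)).
have E1 x : f (s (p x)) = f x.
  by apply/eqP; rewrite -subr_eq0 -linearB pf // linearB sK subrr.
have fl : linear (fun y => f (s y)).
  move=> a x y; rewrite -[in LHS](sK x) -[in LHS](sK y) -linearP E1.
  by rewrite linearP.
pose f' : {linear Q -> E} :=
  HB.pack (fun y => f (s y)) (GRing.isLinear.Build _ _ _ _ _ fl).
by exists f' => x; exact: E1.
Qed.

Section ComodAlgebra.
Variables (k : fieldType) (H : hopfAlgType k) (A : comodAlgType H).
Local Notation Hk := (restr H^o).
Local Notation Ak := (restr A^o).
Local Notation "x ⋅ y" := (@hmul k H x y) (at level 40, left associativity).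
Local Notation e := (@counit k H).
Local Notation D := (@comul k H).

Lemma pure_linearl (U V : lmodType k) (v : V) : linear (fun u : U => pure u v).
Proof. by move=> a x y; rewrite pureDl pureZl. Qed.
Lemma pure_linearr (U V : lmodType k) (u : U) : linear (fun v : V => pure u v).
Proof. by move=> a x y; rewrite pureDr pureZr. Qed.

Lemma tens_act_tsum (V : lmodType H) (M : lmodType A)
    (x : tensor Hk Ak) (v : V) (m : M) :
  tens_act x (pure (v : restr V) (m : restr M)) =
  tsum x (fun h b => pure (((h : H) *: v : V) : restr V) (((b : A) *: m : M) : restr M)).
Proof.
rewrite (linear_tsum x (tens_act_linearl _)); apply: eq_tsum => h b.
exact: tens_act_pure.
Qed.

Lemma tensM_scale_pure (V : lmodType H) (M : lmodType A) (a : A) (v : V) (m : M) :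
  a *: tens_pure v m =
  tsum (coact a) (fun h b => tens_pure ((h : H) *: v) ((b : A) *: m)).
Proof. exact: tens_act_tsum. Qed.

Lemma coact_counit_tsum (W : lmodType k) (F : Ak -> W) (a : Ak) : linear F ->
  tsum (coact a) (fun h b => e h *: F b) = F a.
Proof.
move=> Fl; have b : bilinear_for *:%R *:%R (fun (x : Hk) (y : Ak) => e x *: y).
  by bil.
rewrite -[in RHS](coact_counit a) (tlift_tsum _ b) (linear_of_tsum _ _ Fl).
by apply: eq_tsum => x y; rewrite (linear_morphZ Fl).
Qed.

Lemma coactA_tsum (W : lmodType k) (F : Hk -> Hk -> Ak -> W) (a : Ak) :
  (forall y z, linear (fun x => F x y z)) ->
  (forall x z, linear (fun y => F x y z)) ->
  (forall x y, linear (F x y)) ->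
  tsum (coact a) (fun x c => tsum (D x) (fun y z => F y z c)) =
  tsum (coact a) (fun x c => tsum (coact c) (fun y d => F x y d)).
Proof.
move=> F1 F2 F3; apply: tsum_coassoc => //.
- exact: comul_linear.
- exact: coact_linear.
- by move=> c; split => ?; [exact: F1|exact: F2].
- exact: coactA.
Qed.

(** The universal property of [V ⊗ M] as an [A]-module: equivariance has to be
    checked on pure tensors only. *)
Lemma tensM_lift (V : lmodType H) (M E : lmodType A)
    (F : restr V -> restr M -> restr E) :
  bilinear_for *:%R *:%R F ->
  (forall (a : A) (v : V) (m : M), (a *: (F v m : E) : E) =
    tsum (coact a) (fun h b => F ((h : H) *: v) ((b : A) *: m))) ->
  exists f : {linear tensM V M -> E}, forall v m, f (tens_pure v m) = F v m.
Proof.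
move=> Fb FA; pose f : tensM V M -> E := tlift F.
have fp v m : f (tens_pure v m) = F v m by exact: (tlift_pure Fb v m).
have f0 : f 0 = 0 by exact: (linear_morph0 (tlift_linear Fb)).
have fD : {morph f : s t / s + t} by exact: (linear_morphD (tlift_linear Fb)).
have fl : linear f.
  move=> a s t; rewrite fD; congr (_ + _).
  elim/tensM_ind: s => [v m|s s' IH IH']; last first.
    by rewrite scalerDr !fD IH IH' scalerDr.
  rewrite fp FA tensM_scale_pure (tsum_morph _ _ f0 fD).
  by apply: eq_tsum => h b; rewrite fp.
pose g : {linear tensM V M -> E} :=
  HB.pack f (GRing.isLinear.Build _ _ _ _ _ fl).
by exists g => v m; exact: fp.
Qed.

Lemma scale_linearl (M : lmodType A) (m : M) :
  linear (fun b : Ak => ((b : A) *: m : M) : restr M).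
Proof. exact: (restr_act_bilinear M).1. Qed.
Lemma scale_linearr (M : lmodType A) (b : A) :
  linear (fun m : restr M => (b *: (m : M) : M) : restr M).
Proof. exact: (restr_act_bilinear M).2. Qed.

(** The scalars of [k] act on [V ⊗ M] in two ways, through the coaction on the
    scalars of [A] and through the tensor product; they agree because the
    coaction preserves [1]. *)
Lemma restr_tensM_scale (V : lmodType H) (M : lmodType A) (c : k)
    (t : restr (tensM V M)) :
  c *: t = c *: (t : tensor (restr V) (restr M)).
Proof.
rewrite -[LHS]/(tens_act (coact (kscal c : A)) (t : tensor (restr V) (restr M))).
have -> : (kscal c : A) = c *: ((1 : A) : Ak) by exact/esym/(@mulr1 A).
rewrite (linear_morphZ coact_linear) coact1.
by rewrite (linear_morphZ (tens_act_linearl _)) tens_act1.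
Qed.

Lemma linear_to_tensM (V : lmodType H) (M : lmodType A) (U : lmodType k)
    (f : U -> tensor (restr V) (restr M)) :
  linear f -> linear (f : U -> restr (tensM V M)).
Proof. by move=> fl a x y; rewrite restr_tensM_scale; exact: fl. Qed.

Lemma tens_pureDr (V : lmodType H) (M : lmodType A) (v : V) :
  {morph (fun m : M => tens_pure v m) : x y / x + y}.
Proof. by move=> x y; exact: pureDr. Qed.

Lemma tens_pure_linearl (V : lmodType H) (M : lmodType A) (U : lmodType k)
    (f : U -> restr V) (m : M) : linear f ->
  linear (fun u => tens_pure (f u : V) m : restr (tensM V M)).
Proof.
by move=> fl; apply: linear_to_tensM => a x y; rewrite /tens_pure fl pureDl pureZl.
Qed.
Lemma tens_pure_linearr (V : lmodType H) (M : lmodType A) (U : lmodType k)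
    (f : U -> restr M) (v : V) : linear f ->
  linear (fun u => tens_pure v (f u : M) : restr (tensM V M)).
Proof.
by move=> fl; apply: linear_to_tensM => a x y; rewrite /tens_pure fl pureDr pureZr.
Qed.

Section Maps.
Variable M : lmodType A.

Lemma counit_tens : exists f : {linear tensM H^o M -> M},
  forall (h : H) (m : M), f (tens_pure (h : H^o) m) = e h *: (m : restr M).
Proof.
apply: (tensM_lift (F := fun (h : Hk) (m : restr M) => e h *: m)); first by bil.
move=> a h m.
transitivity (tsum (coact a) (fun x b => e x *: (e h *: (((b : A) *: m : M) : restr M)))).
  rewrite (coact_counit_tsum (F := fun b => e h *: (((b : A) *: m : M) : restr M))).
    by rewrite (linear_morphZ (scale_linearr _)).
  by apply: linear_scale_right; exact: scale_linearl.
by apply: eq_tsum => x b; rewrite scalerA -counitM.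
Qed.


Lemma tens_pure_tsumr (V : lmodType H) (U W : lmodType k) (v : V) (t : tensor U W)
    (F : U -> W -> M) :
  tens_pure v (tsum t F) = tsum t (fun x y => tens_pure v (F x y)).
Proof.
apply: (tsum_morph _ _ _ (tens_pureDr v)).
by apply: (addIr (tens_pure v 0)); rewrite -tens_pureDr !add0r.
Qed.

Lemma scaler_tsum (U W : lmodType k) (a : A) (t : tensor U W) (F : U -> W -> M) :
  a *: tsum t F = tsum t (fun x y => a *: F x y).
Proof.
by apply: tsum_morph; [exact: scaler0|exact: scalerDr].
Qed.
End Maps.


Section Maps2.
Variable M : lmodType A.

(** The comultiplication [H -> H ⊗ H] is [H]-linear, hence induces [A]-maps.  With
    [counit_tens] it makes [H ⊗ -] a comonad on [A]-modules. *)
Lemma comul_tens : exists f : {linear tensM H^o M -> tensM H^o (tensM H^o M)},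
  forall (h : H) (m : M), f (tens_pure (h : H^o) m) =
  tsum (D h) (fun x y => tens_pure (x : H^o) (tens_pure (y : H^o) m)).
Proof.
pose F x y (m : restr M) : restr (tensM H^o (tensM H^o M)) :=
  tens_pure (x : H^o) (tens_pure (y : H^o) (m : M)).
have F1 y m : linear (fun x : Hk => F x y m).
  exact: tens_pure_linearl (@linear_id _ _).
have F2 x m : linear (fun y : Hk => F x y m).
  exact: tens_pure_linearr (tens_pure_linearl _ (@linear_id _ _)).
have F3 x y : linear (fun m => F x y m).
  exact: tens_pure_linearr (tens_pure_linearr _ (@linear_id _ _)).
apply: (tensM_lift (F := fun h m => tsum (D h) (fun x y => F x y m))).
  split=> [m|h] /=.
    by apply: linear_tsum_left; [move=> v; exact: F1|move=> v; exact: F2|exact: comul_linear].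
  by apply: linear_tsum_right => x y; exact: F3.
move=> a h m.
transitivity (tsum (coact a) (fun x b => tsum (D x) (fun y z =>
    tsum (D h) (fun p q => F (y ⋅ p) (z ⋅ q) ((b : A) *: m))))); last first.
  apply: eq_tsum => x b.
  rewrite -[(x : H) *: h]/((x : H) * (h : H)) -hmulE comulM_tsum //.
  by split=> [z|y]; [exact: F1|exact: F2].
rewrite (coactA_tsum (F := fun y z b => 
    tsum (D h) (fun p q => F (y ⋅ p) (z ⋅ q) ((b : A) *: m)))); last first.
- move=> x y; apply: linear_tsum_right => p q; apply: linear_compose (F3 _ _) _.
  exact: scale_linearl.
- move=> x z; apply: linear_tsum_right => p q; apply: linear_compose (F2 _ _) _.
  exact: hmul_linearl (@linear_id _ _).
- move=> x z; apply: linear_tsum_right => p q; apply: linear_compose (F1 _ _) _.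
  exact: hmul_linearl (@linear_id _ _).
rewrite scaler_tsum.
transitivity (tsum (D h) (fun p q => tsum (coact a) (fun x b => tsum (coact b)
    (fun y c => F (x ⋅ p) (y ⋅ q) ((c : A) *: m))))).
  apply: eq_tsum => p q; rewrite tensM_scale_pure; apply: eq_tsum => x b.
  rewrite tensM_scale_pure tens_pure_tsumr; apply: eq_tsum => y c.
  by rewrite !hmulE.
rewrite exchange_tsum; apply: eq_tsum => x b.
exact: exchange_tsum.
Qed.

Lemma contract_tens (g : Hk -> Hk -> k^o) : invariant_pairing g ->
  exists f : {linear tensM H^o (tensM H^o M) -> M}, forall (h l : H) (m : M),
  f (tens_pure (h : H^o) (tens_pure (l : H^o) m)) = (g h l : k) *: (m : restr M).
Proof.
move=> [gb gi].
pose F h l (m : restr M) : restr M := (g h l : k) *: m.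
have F1 l m : linear (fun h => F h l m).
  by move=> c x y; rewrite /F (gb.1 l) scalerDl scalerA.
have F2 h m : linear (fun l => F h l m).
  by move=> c x y; rewrite /F (gb.2 h) scalerDl scalerA.
have F3 h l : linear (F h l) by exact: linear_scale_right (@linear_id _ _).
have Fb h : bilinear_for *:%R *:%R (F h) by split.
have ll h : linear (tlift (F h) : restr (tensM H^o M) -> restr M).
  by move=> c s t; rewrite restr_tensM_scale; exact: (tlift_linear (Fb h)).
have lr t : linear (fun h : Hk => tlift (F h) t).
  move=> c x y; rewrite !tlift_tsum //.
  exact: (linear_tsum_right t (fun l m => F1 l m)).
have [f fE] : exists f : {linear tensM H^o (tensM H^o M) -> M},
  forall (h : H^o) t, f (tens_pure h t) = tlift (F h) t; last first.
  by exists f => h l m; rewrite fE; exact: (tlift_pure (Fb h)).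
apply: (tensM_lift (F := fun h (t : restr (tensM H^o M)) => tlift (F h) t)).
  by split=> [t|h] /=; [exact: lr|exact: ll].
move=> a h t.
have tD x : {morph (fun t : tensM H^o M => tlift (F x) t : M) : s t / s + t}.
  exact: (linear_morphD (tlift_linear (Fb x))).
have t0 x : tlift (F x) (0 : tensM H^o M) = 0.
  exact: (linear_morph0 (tlift_linear (Fb x))).
elim/tensM_ind: t => [l m|s t IHs IHt]; last first.
  rewrite tD scalerDr IHs IHt /tsum -big_split; apply: eq_bigr => p _.
  by rewrite scalerDr tD.
transitivity (tsum (coact a) (fun x b => tsum (D x) (fun y z =>
    F (y ⋅ h) (z ⋅ l) ((b : A) *: m)))).
  transitivity (tsum (coact a) (fun x b => e x *: F h l ((b : A) *: m))).
    rewrite (coact_counit_tsum (F := fun b : Ak => F h l ((b : A) *: m))); last first.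
      exact: linear_compose (F3 h l) (scale_linearl m).
    rewrite [X in _ *: X](tlift_pure (Fb h)).
    exact: (linear_morphZ (scale_linearr a)).
  apply: eq_tsum => x b; rewrite scalerA.
  rewrite -[e x * _]/(e x *: g h l) -gi /tsum scaler_suml.
  by apply: eq_bigr.
rewrite (coactA_tsum (F := fun y z b => F (y ⋅ h) (z ⋅ l) ((b : A) *: m))).
- apply: eq_tsum => x b; rewrite tensM_scale_pure (tsum_morph _ _ (t0 _) (tD _)).
  by apply: eq_tsum => y c; rewrite [RHS](tlift_pure (Fb _)) !hmulE.
- move=> y z; apply: linear_compose (F1 _ _) _.
  exact: hmul_linearl (@linear_id _ _).
- move=> y z; apply: linear_compose (F2 _ _) _.
  exact: hmul_linearl (@linear_id _ _).
- move=> y z; apply: linear_compose (F3 _ _) _; exact: scale_linearl.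
Qed.

End Maps2.
End ComodAlgebra.

(** * The modules H ⊗ N as injectives and projectives *)

Section Injectivity.
Variables (k : fieldType) (H : hopfAlgType k) (Lam : H) (A : comodAlgType H).
Hypotheses (intL : left_integral Lam) (fdH : finite_dimensional (restr H^o)).
Local Notation Hk := (restr H^o).
Local Notation e := (@counit k H).
Local Notation D := (@comul k H).
Local Notation Lam' := (Lam : H^o).

(** The functor [I = H ⊗ -] on morphisms. *)
Definition freemap (M N : lmodType A) (f : {linear M -> N}) :
  {linear tensM H^o M -> tensM H^o N} := tensM_map (idfun : {linear H^o -> H^o}) f.

Lemma freemap_pure (M N : lmodType A) (f : {linear M -> N}) (h : H^o) m :
  freemap f (tens_pure h m) = tens_pure h (f m).
Proof. exact: tensM_map_pure. Qed.

Lemma shift_map_pure (M N : lmodType A) (f : {linear M -> N}) h m :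
  shift_map Lam f (tens_pure h m) = tens_pure h (f m).
Proof. exact: tensM_map_pure. Qed.

Lemma shift_proj_pure (M : lmodType A) (h : H^o) (m : M) :
  shift_proj Lam M (tens_pure h m) = tens_pure (quot_integral_class Lam h) m.
Proof. exact: tensM_map_pure. Qed.

Lemma shift_map_proj (M N : lmodType A) (f : {linear M -> N}) t :
  shift_map Lam f (shift_proj Lam M t) = shift_proj Lam N (freemap f t).
Proof.
elim/tensM_ind: t => [h m|s t IHs IHt]; last by rewrite !linearD IHs IHt.
by rewrite freemap_pure !shift_proj_pure shift_map_pure.
Qed.

(** [H ⊗ N] is injective relative to the maps [m ↦ Lam ⊗ m]: compose
    [I f : I M -> I (I N)] with [h ⊗ l ⊗ n ↦ g(h, l_1) l_2 ⊗ n], where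
    [g(Lam, l) = eps l]. *)
Lemma free_extension (M N : lmodType A) (f : {linear M -> tensM H^o N}) :
  exists s : {linear tensM H^o M -> tensM H^o N},
    forall m, s (tens_pure Lam' m) = f m.
Proof.
have [g [gi gL]] := left_integral_pairing intL fdH.
have [d dE] := comul_tens N.
have [c cE] := contract_tens (tensM H^o N) gi.
exists (c \o (freemap d \o freemap f)) => m /=.
rewrite !freemap_pure; elim/tensM_ind: (f m) => [l n|s t IHs IHt]; last first.
  by rewrite linearD tens_pureDr linearD IHs IHt.
rewrite dE tens_pure_tsumr (tsum_morph _ _ (linear0 c) (linearD c)).
transitivity (tsum (D l) (fun x y => e x *:
    (tens_pure (y : H^o) n : restr (tensM H^o N)))).
  by apply: eq_tsum => x y; rewrite cE gL.
apply: (counitl_tsum (F := fun y => tens_pure (y : H^o) n : restr (tensM H^o N))).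
exact: tens_pure_linearl (@linear_id _ _).
Qed.

(** A factorization through any [H ⊗ P] can be moved to the single map
    [m ↦ Lam ⊗ m] by extending its first half. *)
Lemma null_homotopicP (M N : lmodType A) (f : M -> N) :
  null_homotopic f <->
  exists s : {linear tensM H^o M -> N}, forall m, f m = s (tens_pure Lam' m).
Proof.
split=> [[P [a [b fE]]]|[s sE]].
  have [s sE] := free_extension a.
  by exists (b \o s) => m /=; rewrite sE fE.
by exists M, (integral_incl intL M), s => m; rewrite sE.
Qed.

Lemma stable_eqP (M N : lmodType A) (f g : {linear M -> N}) :
  stable_class f = stable_class g <->
  exists s : {linear tensM H^o M -> N},
    forall m, f m = g m + s (tens_pure Lam' m).
Proof.
rewrite stable_classP null_homotopicP; split=> -[s sE]; exists s => m.
  by rewrite -sE /= addrC subrK.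
by rewrite /= sE addrC addKr.
Qed.

Lemma stable_eq (M N P : lmodType A) (f g : {linear M -> N})
    (a : {linear M -> tensM H^o P}) (b : {linear tensM H^o P -> N}) :
  (forall m, f m = g m + b (a m)) -> stable_class f = stable_class g.
Proof.
move=> E; apply/stable_classP; exists P, a, b => m.
by rewrite /= E addrC addKr.
Qed.

(** [h ↦ h - l(h) Lam] kills [Lam] because [l(Lam) = 1], so it descends to a
    [k]-linear section of the projection [H -> H / k Lam]. *)
Lemma quot_integral_section : exists (l : Hk -> k)
    (s : {linear restr (quot_integral Lam) -> Hk}),
  [/\ scalar l, l Lam = 1 &
     forall h : H, s (quot_integral_class Lam h) = (h : Hk) - l h *: (Lam : Hk)].
Proof.
have [l [ll lL]] := finite_dimensional_functional fdH intL.1.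
have pl := restr_linear (quot_integral_class Lam).
pose p : {linear Hk -> restr (quot_integral Lam)} :=
  HB.pack (quot_integral_class Lam : Hk -> restr (quot_integral Lam))
    (GRing.isLinear.Build _ _ _ _ _ pl).
have fl : linear (fun h : Hk => h - l h *: (Lam : Hk)).
  move=> c x y; rewrite ll scalerBr scalerDl scalerA.
  by rewrite opprD addrACA.
pose f : {linear Hk -> Hk} := HB.pack (fun h : Hk => h - l h *: (Lam : Hk))
  (GRing.isLinear.Build _ _ _ _ _ fl).
have [|h|s sE] := @linear_descent k _ _ _ p f.
- by move=> y; exists (quot_repr y); exact: quot_reprK.
- move=> /(quot_integralP h intL)[c ->].
  rewrite -[_ * _]/(c *: (Lam : Hk)) /=.
  have -> : l (c *: (Lam : Hk)) = c.
    have := ll c (Lam : Hk) 0; rewrite addr0 => ->.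
    have -> : l 0 = 0 by exact: (linear_morph0 (ll : linear (l : Hk -> k^o))).
    by rewrite lL addr0 mulr1.
  exact: subrr.
- by exists l, s; split=> // h; exact: sE.
Qed.

(** The section of [H -> H / k Lam] tensored with [M].  It gives the exactness of
    [0 -> M -> H ⊗ M -> T M -> 0] without exactness of tensor products. *)
Lemma shift_proj_section (M : lmodType A) :
  exists (s : shift_obj Lam M -> tensM H^o M) (c : tensM H^o M -> M),
  [/\ linear (s : restr (shift_obj Lam M) -> restr (tensM H^o M)),
      forall t, s (shift_proj Lam M t) = t - tens_pure Lam' (c t) &
      forall m, c (tens_pure Lam' m) = m].
Proof.
have [l [s [ll lL sE]]] := quot_integral_section.
have cb : bilinear_for *:%R *:%R (fun (h : Hk) (m : restr M) => l h *: m).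
  split=> [m|h]; last exact: linear_scale_right (@linear_id _ _).
  exact: (linear_scale_left _ ll (@linear_id _ _)).
have cl := tlift_linear cb.
have idl : linear (id : restr M -> restr M) by [].
have sl : linear (s : restr (quot_integral Lam) -> Hk) by exact: linearP.
have tl := tmap_linear sl idl.
pose c : tensM H^o M -> M := tlift (fun (h : Hk) (m : restr M) => l h *: m).
have cE (h : H^o) m : c (tens_pure h m) = (l h *: (m : restr M)).
  exact: (tlift_pure cb).
pose r : shift_obj Lam M -> tensM H^o M := tmap s id.
have rD : {morph r : x y / x + y} by exact: (linear_morphD tl).
have cD : {morph c : x y / x + y} by exact: (linear_morphD cl).
exists r, c; split.
- by move=> a x y; rewrite !restr_tensM_scale; exact: tl.
- elim/tensM_ind => [h m|x y IHx IHy].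
    rewrite shift_proj_pure [LHS](tmap_pure sl idl) sE.
    by rewrite cE /tens_pure pureDl -scaleNr pureZl pureZr scaleNr.
  by rewrite linearD rD IHx IHy cD tens_pureDr opprD addrACA.
- by move=> m; rewrite cE lL scale1r.
Qed.

Lemma shift_proj_surj (M : lmodType A) (t : shift_obj Lam M) :
  exists x, shift_proj Lam M x = t.
Proof.
elim/tensM_ind: t => [q m|s t [x <-] [y <-]]; last first.
  by exists (x + y); rewrite linearD.
exists (tens_pure (quot_repr q : H^o) m); rewrite shift_proj_pure.
by congr tens_pure; exact: quot_reprK.
Qed.

Lemma shift_proj_integral (M : lmodType A) (m : M) :
  shift_proj Lam M (tens_pure Lam' m) = 0.
Proof.
rewrite shift_proj_pure; have -> : quot_integral_class Lam Lam' = 0.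
  by apply/(quot_integralP Lam intL); exists 1; rewrite kscal1 mul1r.
exact: (linear_morph0 (pure_linearl (U := restr (quot_integral Lam)) (m : restr M))).
Qed.

Lemma shift_proj_ker (M : lmodType A) (t : tensM H^o M) :
  shift_proj Lam M t = 0 -> exists m, t = tens_pure Lam' m.
Proof.
have [s [c [sl sE _]]] := shift_proj_section M.
move=> t0; exists (c t); apply/eqP; rewrite -subr_eq0 -sE t0.
by apply/eqP; exact: (linear_morph0 sl).
Qed.

Lemma tens_integral_inj (M : lmodType A) : injective (tens_pure Lam' : M -> _).
Proof.
by have [s [c [_ _ cE]]] := shift_proj_section M; exact: can_inj cE.
Qed.

Lemma shift_descent (M N : lmodType A) (f : {linear tensM H^o M -> N}) :
  (forall m, f (tens_pure Lam' m) = 0) ->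
  exists f' : {linear shift_obj Lam M -> N},
    forall t, f' (shift_proj Lam M t) = f t.
Proof.
move=> f0; apply: linear_descent; first exact: shift_proj_surj.
by move=> t /shift_proj_ker[m ->].
Qed.

Lemma shift_ext (M N : lmodType A) (f g : {linear shift_obj Lam M -> N}) :
  (forall t, f (shift_proj Lam M t) = g (shift_proj Lam M t)) -> f =1 g.
Proof. by move=> fg t; have [x <-] := shift_proj_surj t. Qed.

(** [H ⊗ N] is projective relative to [pi : I Y -> T Y].  By the comonad structure
    of [H ⊗ -] it is enough to lift the counit [I (T Y) -> T Y].  On
    [I (I Y)] the map [h ⊗ l ⊗ y ↦ eps(h) l ⊗ y - b(h, l) Lam ⊗ y] lifts it, and
    it factors through [I (T Y)] since [b(h, Lam) = eps(h)]. *)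
Lemma free_lift_shift (N Y : lmodType A)
    (g : {linear tensM H^o N -> shift_obj Lam Y}) :
  exists g' : {linear tensM H^o N -> tensM H^o Y},
    forall t, shift_proj Lam Y (g' t) = g t.
Proof.
have [b [bi bL]] := right_integral_pairing intL fdH.
have [s [c [sl sE cE]]] := shift_proj_section Y.
have sK t : shift_proj Lam Y (s t) = t.
  have [x <-] := shift_proj_surj t.
  by rewrite sE linearB shift_proj_integral subr0.
have [q qE] := counit_tens (tensM H^o Y).
have [r rE] := contract_tens Y bi.
pose F : {linear tensM H^o (tensM H^o Y) -> tensM H^o Y} :=
  q \- (integral_incl intL Y \o r).
have FE t : F t = q t - tens_pure Lam' (r t) by [].
have F0 h t : shift_proj Lam Y t = 0 -> F (tens_pure h t) = 0.
  move=> /shift_proj_ker[y ->]; rewrite FE qE rE bL.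
  rewrite restr_tensM_scale /tens_pure pureZr.
  exact: subrr.
have Fs h t t' : shift_proj Lam Y t = shift_proj Lam Y t' ->
    F (tens_pure h t) = F (tens_pure h t').
  move=> tt'; apply/eqP; rewrite -subr_eq0 -linearB.
  have -> : tens_pure h t - tens_pure h t' = tens_pure h (t - t').
    apply: (addIr (tens_pure h t')); rewrite subrK.
    by rewrite -tens_pureDr subrK.
  by rewrite F0 // linearB tt' subrr.
(* Choosing preimages with the [k]-linear section [s] keeps [A]-linearity, since [F]
   does not depend on the choice. *)
have [f fE] : exists f : {linear tensM H^o (shift_obj Lam Y) -> tensM H^o Y},
    forall h t, f (tens_pure h t) = F (tens_pure h (s t)).
  apply: (tensM_lift (F := fun (h : Hk) (t : restr (shift_obj Lam Y)) =>
      F (tens_pure (h : H^o) (s t)) : restr (tensM H^o Y))).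
    have Fl := restr_linear F.
    split=> [t|h]; apply: (linear_compose Fl).
      exact: tens_pure_linearl (@linear_id _ _).
    exact: tens_pure_linearr sl.
  move=> a h t; rewrite -linearZ tensM_scale_pure.
  rewrite (tsum_morph _ _ (linear0 F) (linearD F)); apply: eq_tsum => x y.
  by apply: Fs; rewrite linearZ !sK.
have [d dE] := comul_tens N.
exists (f \o (freemap g \o d)).
apply: tensM_ind => [h n|x y IHx IHy]; last by rewrite !linearD IHx IHy.
rewrite /= dE.
pose G : {linear tensM H^o (tensM H^o N) -> shift_obj Lam Y} :=
  shift_proj Lam Y \o (f \o freemap g).
have GE x y : G (tens_pure (x : H^o) (tens_pure (y : H^o) n)) =
    e x *: (g (tens_pure (y : H^o) n) : restr (shift_obj Lam Y)).
  rewrite -[LHS]/(shift_proj Lam Y (f (freemap g _))) freemap_pure fE FE qE.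
  rewrite (linearB (shift_proj Lam Y)) shift_proj_integral subr0.
  rewrite -[X in shift_proj Lam Y X]/((kscal (e x) : A) *: s _) linearZ.
  by rewrite sK.
transitivity (tsum (D h) (fun x y => G (tens_pure (x : H^o) (tens_pure (y : H^o) n)))).
  exact: (tsum_morph (f := G) _ _ (linear0 G) (linearD G)).
transitivity (tsum (D h) (fun x y => e x *:
    (g (tens_pure (y : H^o) n) : restr (shift_obj Lam Y)))).
  by apply: eq_tsum => x y; rewrite GE.
apply: (counitl_tsum (F := fun y : Hk => g (tens_pure (y : H^o) n)
  : restr (shift_obj Lam Y))).
apply: (linear_compose (restr_linear g)).
exact: tens_pure_linearl (@linear_id _ _).
Qed.

End Injectivity.

(** * Syzygies *)

Section Augmentation.
Variables (k : fieldType) (H : hopfAlgType k).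
Local Notation Hk := (restr H^o).
Local Notation e := (@counit k H).

Definition aug : {pred H^o} := fun h : H => e h == 0.

Fact aug_submod_closed : submod_closed aug.
Proof.
have el : linear (e : Hk -> k^o) := @counit_linear k H.
split; first by apply/eqP; exact: (linear_morph0 el).
move=> a u v /eqP u0 /eqP v0; apply/eqP.
rewrite (linear_morphD el) -[a *: u]/((a : H) * (u : H)) counitM.
by rewrite u0 v0 mulr0 addr0.
Qed.
HB.instance Definition _ := GRing.isSubmodClosed.Build H H^o aug aug_submod_closed.
HB.instance Definition _ := GRing.isOppClosed.Build H^o aug
  (GRing.zmod_closedN (GRing.submod_closedB aug_submod_closed)).

Record aug_ideal := AugIdeal { aug_val : H^o; aug_valP : aug_val \in aug }.
HB.instance Definition _ := [isSub for aug_val].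
HB.instance Definition _ := [Choice of aug_ideal by <:].
HB.instance Definition _ := [SubChoice_isSubLmodule of aug_ideal by <:].

Definition aug_incl : {linear aug_ideal -> H^o} := val.

Fact aug_projP (h : H) : ((h : Hk) - e h *: ((1 : H) : Hk) : H^o) \in aug.
Proof.
have el : linear (e : Hk -> k^o) := @counit_linear k H.
apply/eqP; rewrite (linear_morphB el) (linear_morphZ el) counit1.
by rewrite -[X in _ - X]/(e h * 1) mulr1 subrr.
Qed.

(** Projection onto the augmentation ideal along [k 1]; it is only [k]-linear. *)
Definition aug_proj (h : Hk) : restr aug_ideal := AugIdeal (aug_projP h).

Lemma aug_inclK (v : aug_ideal) : aug_proj (aug_incl v) = v.
Proof.
apply: val_inj => /=; have /eqP -> := aug_valP v.
by rewrite scale0r subr0.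
Qed.

Lemma aug_proj_linear : linear aug_proj.
Proof.
move=> a x y; apply: val_inj.
change (((a *: x + y : Hk) - e (a *: x + y) *: ((1 : H) : Hk)) =
  a *: (x - e x *: ((1 : H) : Hk)) + (y - e y *: ((1 : H) : Hk))).
rewrite counit_linear scalerBr scalerDl scalerA opprD addrACA //.
Qed.

End Augmentation.

Section Syzygy.
Variables (k : fieldType) (H : hopfAlgType k) (Lam : H) (A : comodAlgType H).
Hypotheses (intL : left_integral Lam) (fdH : finite_dimensional (restr H^o)).
Local Notation Hk := (restr H^o).
Local Notation e := (@counit k H).
Local Notation D := (@comul k H).
Local Notation Lam' := (Lam : H^o).
Local Notation one := ((1 : H) : Hk).

(** [O = Ker eps ⊗ M] sits in [0 -> O -> I M -> M -> 0].  The map [r]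
    extends [O -> I O] along [j], so this sequence can be compared with
    [0 -> O -> I O -> T O -> 0]; it is
    [t ↦ Lam ⊗ t - Lam_1 ⊗ Lam_2 ⊗ q t], which has zero counit in the second
    factor and therefore values in [H ⊗ Ker eps ⊗ M]. *)
Lemma syzygy (M : lmodType A) :
  exists (O : lmodType A) (j : {linear O -> tensM H^o M})
    (q : {linear tensM H^o M -> M}) (r : {linear tensM H^o M -> tensM H^o O}),
  [/\ forall m, exists t, q t = m, forall x, q (j x) = 0,
      forall t, q t = 0 -> exists x, t = j x &
      forall x, r (j x) = tens_pure Lam' x].
Proof.
pose O : lmodType A := tensM (aug_ideal H) M.
pose j : {linear O -> tensM H^o M} := tensM_map (aug_incl H) idfun.
have jE v m : j (tens_pure v m) = tens_pure (aug_incl H v) m.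
  exact: tensM_map_pure.
have [q qE] := counit_tens M.
have [d dE] := comul_tens M.
have el : linear (e : Hk -> k^o) := @counit_linear k H.
have idl : linear (id : restr M -> restr M) by [].
have pl := tmap_linear (@aug_proj_linear k H) idl.
pose p : tensM H^o M -> O := tmap (@aug_proj k H) id.
have pE h m : p (tens_pure h m) = tens_pure (aug_proj h : aug_ideal H) m.
  exact: (tmap_pure (@aug_proj_linear k H) idl).
have pD : {morph p : x y / x + y} by exact: (linear_morphD pl).
have pj x : p (j x) = x.
  elim/tensM_ind: x => [v m|x y IHx IHy]; last by rewrite linearD pD IHx IHy.
  by rewrite jE pE aug_inclK.
have jp x : j (p x) = x - tens_pure (1 : H^o) (q x).
  elim/tensM_ind: x => [h m|x y IHx IHy]; last first.
    by rewrite pD !linearD IHx IHy tens_pureDr opprD addrACA.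
  rewrite pE jE qE /=.
  rewrite /tens_pure pureDl -[X in _ + X = _]/(pure (- (e h *: one)) _).
  by rewrite -scaleNr pureZl pureZr scaleNr.
have qj x : q (j x) = 0.
  elim/tensM_ind: x => [v m|x y IHx IHy]; last by rewrite !linearD IHx IHy addr0.
  by rewrite jE qE; have /eqP -> := aug_valP v; rewrite scale0r.
(* The map [r] followed by the inclusion of [I O] into [I (I M)]. *)
pose z : {linear tensM H^o M -> tensM H^o (tensM H^o M)} :=
  integral_incl intL _ \- (d \o (integral_incl intL M \o q)).
have zE t : z t = tens_pure Lam' t - d (tens_pure Lam' (q t)) by [].
have qd t : freemap q (d t) = t.
  elim/tensM_ind: t => [h m|s t IHs IHt]; last by rewrite !linearD IHs IHt.
  rewrite dE (tsum_morph (f := freemap q) _ _ (linear0 _) (linearD _)).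
  transitivity (tsum (D h) (fun x y => e y *:
      (tens_pure (x : H^o) m : restr (tensM H^o M)))).
    apply: eq_tsum => x y; rewrite freemap_pure qE restr_tensM_scale.
    exact: pureZr.
  apply: (counitr_tsum (F := fun x => tens_pure (x : H^o) m : restr (tensM H^o M))).
  exact: tens_pure_linearl (@linear_id _ _).
have qz t : freemap q (z t) = 0.
  by rewrite zE linearB freemap_pure qd subrr.
have pl' : linear (p : restr (tensM H^o M) -> restr O).
  by move=> c x y; rewrite !restr_tensM_scale; exact: pl.
have idH : linear (id : Hk -> Hk) by [].
pose P : tensM H^o (tensM H^o M) -> tensM H^o O :=
  tmap (id : Hk -> Hk) (p : restr (tensM H^o M) -> restr O).
have PE h t : P (tens_pure h t) = tens_pure h (p t) by exact: (tmap_pure idH pl').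
have PD : {morph P : x y / x + y} by exact: (linear_morphD (tmap_linear idH pl')).
have PJ t : P (freemap j t) = t.
  elim/tensM_ind: t => [h x|s t IHs IHt]; last by rewrite linearD PD IHs IHt.
  by rewrite freemap_pure PE pj.
have il : linear ((fun m => tens_pure (1 : H^o) (m : M)) :
    restr M -> restr (tensM H^o M)).
  exact: tens_pure_linearr (@linear_id _ _).
pose u : tensM H^o M -> tensM H^o (tensM H^o M) :=
  tmap (id : Hk -> Hk) ((fun m => tens_pure (1 : H^o) (m : M)) :
    restr M -> restr (tensM H^o M)).
have uE h m : u (tens_pure h m) = tens_pure h (tens_pure (1 : H^o) m).
  exact: (tmap_pure idH il).
have uD : {morph u : x y / x + y} by exact: (linear_morphD (tmap_linear idH il)).
have u0 : u 0 = 0 by apply: (addIr (u 0)); rewrite -uD !add0r.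
have JP t : freemap j (P t) = t - u (freemap q t).
  elim/tensM_ind: t => [h x|s t IHs IHt]; last first.
    by rewrite PD !linearD uD IHs IHt opprD addrACA.
  rewrite PE !freemap_pure jp uE.
  apply: (addIr (tens_pure h (tens_pure (1 : H^o) (q x)))).
  by rewrite subrK -tens_pureDr subrK.
have JPz t : freemap j (P (z t)) = z t by rewrite JP qz u0 subr0.
(* [P] is only [k]-linear, but [P z] is [A]-linear because the injective map
   [freemap j] turns it into [z]. *)
have rl : linear (fun t => P (z t)).
  move=> a x y; apply: (can_inj PJ).
  rewrite JPz [RHS]linearP !JPz; exact: linearP.
pose r : {linear tensM H^o M -> tensM H^o O} :=
  HB.pack (fun t => P (z t)) (GRing.isLinear.Build _ _ _ _ _ rl).
exists O, j, q, r; split=> //.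
- move=> m; exists (tens_pure (1 : H^o) m).
  by rewrite qE counit1 scale1r.
- by move=> t qt; exists (p t); rewrite jp qt -[tens_pure _ 0]/(pure one _)
    (linear_morph0 (@pure_linearr k Hk (restr M) one)) subr0.
- move=> x; apply: (can_inj PJ); rewrite JPz zE qj freemap_pure.
  have -> : tens_pure Lam' (0 : M) = 0.
    by apply: (addIr (tens_pure Lam' (0 : M))); rewrite -tens_pureDr !add0r.
  by rewrite linear0 subr0.
Qed.

End Syzygy.

(** * The shift functor *)

Local Notation "g '∘' f" := (comp g f) (at level 40, left associativity).

Section PreadditiveCategory.
Variables (C : preaddCat).

Lemma comp0m (X Y Z : C) (f : hom X Y) : (0 : hom Y Z) ∘ f = 0.
Proof. by apply: (addIr ((0 : hom Y Z) ∘ f)); rewrite -compDl !add0r. Qed.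
Lemma compm0 (X Y Z : C) (f : hom Y Z) : f ∘ (0 : hom X Y) = 0.
Proof. by apply: (addIr (f ∘ (0 : hom X Y))); rewrite -compDr !add0r. Qed.
Lemma compNm (X Y Z : C) (g : hom Y Z) (f : hom X Y) : (- g) ∘ f = - (g ∘ f).
Proof. by apply: (addIr (g ∘ f)); rewrite -compDl !addNr comp0m. Qed.
Lemma compmN (X Y Z : C) (g : hom Y Z) (f : hom X Y) : g ∘ (- f) = - (g ∘ f).
Proof. by apply: (addIr (g ∘ f)); rewrite -compDr !addNr compm0. Qed.
Lemma compBl (X Y Z : C) (g g' : hom Y Z) (f : hom X Y) :
  (g - g') ∘ f = g ∘ f - g' ∘ f.
Proof. by rewrite compDl compNm. Qed.
Lemma compBr (X Y Z : C) (g : hom Y Z) (f f' : hom X Y) :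
  g ∘ (f - f') = g ∘ f - g ∘ f'.
Proof. by rewrite compDr compmN. Qed.

Lemma is_iso_id (X : C) : is_iso (idm X).
Proof. by exists (idm X); rewrite comp1m. Qed.
Lemma is_iso_comp (X Y Z : C) (g : hom Y Z) (f : hom X Y) :
  is_iso g -> is_iso f -> is_iso (g ∘ f).
Proof.
move=> [g' [g'g gg']] [f' [f'f ff']]; exists (f' ∘ g'); split.
  by rewrite compA -(compA f') g'g compm1.
by rewrite compA -(compA g) ff' compm1.
Qed.

(** The inverse functor sends [Y] to a chosen preimage up to isomorphism, and
    morphisms are lifted along [F] after conjugation with the isomorphisms. *)
Lemma ff_es_autoequivalence (F : endo C) : is_functor F ->
  (forall (X Y : C) (h : hom (F X) (F Y)), exists g, emap F g = h) ->
  (forall (X Y : C) (f g : hom X Y), emap F f = emap F g -> f = g) ->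
  (forall Y : C, exists (X : C) (f : hom (F X) Y), is_iso f) ->
  is_autoequivalence F.
Proof.
move=> Ff full faith es; split=> //; have [F1 FM] := Ff.
pose Go (Y : C) : C := sval (cid (es Y)).
have Ge (Y : C) : {f : hom (F (Go Y)) Y & {f' | f' ∘ f = idm _ /\ f ∘ f' = idm _}}.
  have [f /cid[f' ff']] := cid (svalP (cid (es Y))).
  by exists f, f'.
pose ep Y := projT1 (Ge Y); pose en Y := sval (projT2 (Ge Y)).
have nK Y : en Y ∘ ep Y = idm _ by have [] := svalP (projT2 (Ge Y)).
have pK Y : ep Y ∘ en Y = idm _ by have [] := svalP (projT2 (Ge Y)).
pose lift (X Y : C) (h : hom (F X) (F Y)) := sval (cid (full X Y h)).
have liftE X Y (h : hom (F X) (F Y)) : emap F (lift X Y h) = h.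
  exact: (svalP (cid (full X Y h))).
pose G : endo C := Endo (eob := Go) (fun X Y f => lift _ _ (en Y ∘ (f ∘ ep X))).
have GE X Y (f : hom X Y) : emap F (emap G f) = en Y ∘ (f ∘ ep X).
  exact: liftE.
have GF : is_functor G.
  split=> [X|X Y Z g f]; apply: faith; first by rewrite GE F1 comp1m nK.
  by rewrite FM !GE -!compA (compA (ep Y) (en Y)) pK comp1m.
exists G, (fun X => lift _ _ (en (F X))), ep; split=> //.
- move=> X; split; last by exists (en X); rewrite nK pK.
  exists (lift _ _ (ep (F X))); split; apply: faith.
    by rewrite FM !liftE F1 pK.
  by rewrite FM !liftE F1 nK.
- move=> X Y f; apply: faith; rewrite !FM !liftE.
  by rewrite -!compA pK compm1.
- by move=> X Y f; rewrite GE [RHS]compA pK comp1m.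
Qed.

End PreadditiveCategory.

Section ShiftFunctor.
Variables (k : fieldType) (H : hopfAlgType k) (Lam : H) (A : comodAlgType H).
Hypotheses (intL : left_integral Lam) (fdH : finite_dimensional (restr H^o)).
Local Notation Lam' := (Lam : H^o).
Local Notation C := (stable_cat A).
Local Notation T := (stable_shift Lam A).
Local Notation proj := (shift_proj Lam).
Local Notation Tm := (shift_map Lam).
Local Notation "⟦ f ⟧" := (stable_class f).

Lemma stable_surj (M N : lmodType A) (F : stable_hom M N) :
  exists f, F = ⟦f⟧.
Proof. by exists (stable_repr F); rewrite stable_reprK. Qed.

(** If [f - g = s iota], then [I f - I g - iota s] vanishes on the image of [iota],
    hence factors as [c pi] with [c : T M -> I N], and [T f - T g = pi c]. *)
Lemma shift_map_stable (M N : lmodType A) (f g : {linear M -> N}) :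
  ⟦f⟧ = ⟦g⟧ -> ⟦Tm f⟧ = ⟦Tm g⟧.
Proof.
move=> /(stable_eqP intL fdH)[s sE].
pose E : {linear tensM H^o M -> tensM H^o N} :=
  (freemap f \- freemap g) \- (integral_incl intL N \o s).
have EE t : E t = freemap f t - freemap g t - tens_pure Lam' (s t) by [].
have [|c cE] := shift_descent intL fdH (f := E).
  move=> m; rewrite EE !freemap_pure sE tens_pureDr.
  by rewrite [X in X - _ - _]addrC addrK subrr.
apply: (stable_eq (a := c) (b := proj N)).
apply: (@shift_ext k H Lam A M (shift_obj Lam N) (Tm f) (Tm g \+ (proj N \o c))) => t /=.
rewrite !shift_map_proj cE EE !(linearB (proj N)) (shift_proj_integral intL) subr0.
by rewrite addrC subrK.
Qed.

Lemma emap_shift (M N : lmodType A) (f : {linear M -> N}) :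
  emap T (⟦f⟧ : hom (M : C) N) = ⟦Tm f⟧.
Proof. by apply: shift_map_stable; exact: stable_reprK. Qed.

Lemma shift_additive : is_additive_functor T.
Proof.
split; first split.
- move=> X; rewrite [LHS](emap_shift (idfun : {linear X -> X})).
  apply: eq_stable_class; elim/tensM_ind => [v m|s t IHs IHt].
    by rewrite shift_map_pure.
  by rewrite linearD IHs IHt.
- move=> X Y Z G F; have [g ->] := stable_surj G; have [f ->] := stable_surj F.
  rewrite [comp _ _](stable_comp_class g f) !emap_shift [RHS]stable_comp_class.
  apply: eq_stable_class; elim/tensM_ind => [v m|s t IHs IHt].
    by rewrite /= !shift_map_pure.
  by rewrite !linearD IHs IHt.
- move=> X Y F G; have [g ->] := stable_surj G; have [f ->] := stable_surj F.
  rewrite -[X in emap _ X]stable_classD !emap_shift -[RHS]stable_classD.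
  apply: eq_stable_class; elim/tensM_ind => [v m|s t IHs IHt].
    by rewrite /= !shift_map_pure tens_pureDr.
  by rewrite !linearD IHs IHt.
Qed.

Lemma integral_factor (P Y : lmodType A) (f : {linear P -> tensM H^o Y}) :
  (forall t, proj Y (f t) = 0) ->
  exists c : {linear P -> Y}, forall t, f t = tens_pure Lam' (c t).
Proof.
move=> f0; pose c t := sval (cid (shift_proj_ker intL fdH (f0 t))).
have cE t : f t = tens_pure Lam' (c t).
  exact: (svalP (cid (shift_proj_ker intL fdH (f0 t)))).
have cl : linear c.
  move=> a x y; apply: (tens_integral_inj intL fdH); rewrite -cE linearP !cE.
  exact/esym/(integral_tens_linear intL a (c x) (c y)).
pose g : {linear P -> Y} := HB.pack c (GRing.isLinear.Build _ _ _ _ _ cl).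
by exists g.
Qed.

(** If [T f - T g] factors through [H ⊗ P], its second half lifts along [pi], so
    [I f - I g] minus a map that vanishes on [iota] has values in the kernel
    [iota Y] of [pi]; the resulting map [I X -> Y] extends [f - g]. *)
Lemma shift_faithful (X Y : C) (F G : hom X Y) : emap T F = emap T G -> F = G.
Proof.
have [f ->] := stable_surj F; have [g ->] := stable_surj G.
rewrite !emap_shift => /stable_classP[P [a [b ab]]].
have [b' bE] := free_lift_shift intL fdH b.
pose E : {linear tensM H^o X -> tensM H^o Y} :=
  (freemap f \- freemap g) \- (b' \o (a \o proj X)).
have EE t : E t = freemap f t - freemap g t - b' (a (proj X t)) by [].
have [|c cE] := integral_factor (f := E).
  move=> t; rewrite EE !(linearB (proj Y)) bE -[b _]ab /= !shift_map_proj.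
  exact: subrr.
apply/(stable_eqP intL fdH); exists c => x.
apply: (tens_integral_inj intL fdH).
rewrite tens_pureDr -cE EE !freemap_pure (shift_proj_integral intL).
by rewrite (linear0 a) (linear0 b') subr0 addrC subrK.
Qed.

(** Lift [f pi : I X -> T Y] to [g : I X -> I Y].  It maps [iota X] to [iota Y],
    which defines [c : X -> Y]; as [I c] and [g] agree on [iota X], [T c] and [f]
    differ by a map that factors through [pi]. *)
Lemma shift_full (X Y : C) (F : hom (T X) (T Y)) : exists G, emap T G = F.
Proof.
have [f ->] := stable_surj F.
have [g gE] := free_lift_shift intL fdH (f \o proj X).
have [|c cE] := @integral_factor _ _ (g \o integral_incl intL X).
  by move=> x; rewrite /= gE /= (shift_proj_integral intL) linear0.
exists ⟦c⟧; rewrite emap_shift.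
pose d0 : {linear tensM H^o X -> tensM H^o Y} := freemap c \- g.
have [|d dE] := shift_descent intL fdH (f := d0).
  by move=> x; rewrite /= freemap_pure -cE; exact: subrr.
apply: (stable_eq (a := d) (b := proj Y)).
apply: (@shift_ext k H Lam A X (shift_obj Lam Y) (Tm c) (f \+ (proj Y \o d))) => t /=.
rewrite shift_map_proj dE /= (linearB (proj Y)) gE /=.
by rewrite addrC subrK.
Qed.

(** [O -> I O -> T O] and the sequence [O -> I Y -> Y] of [syzygy] map to each
    other over the identity of [O].  On the middle terms the composites differ
    from the identities by maps that vanish on [O], so on the third terms they
    differ from the identities by maps through [I O] and [I Y]. *)
Lemma shift_essentially_surjective (Y : C) :
  exists (X : C) (f : hom (T X) Y), is_iso f.
Proof.
have [O [j [q [r [qs qj qker rj]]]]] := syzygy intL Y.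
have [a aE] := free_extension intL fdH j.
have [|f fE] := shift_descent intL fdH (f := q \o a).
  by move=> m; rewrite /= aE qj.
have [|g gE] := linear_descent (f := proj O \o r) qs.
  by move=> t /qker[x ->]; rewrite /= rj (shift_proj_integral intL).
pose d0 : {linear tensM H^o O -> tensM H^o O} := (r \o a) \- idfun.
have [|d dE] := shift_descent intL fdH (f := d0).
  by move=> m; rewrite /= aE rj subrr.
pose c0 : {linear tensM H^o Y -> tensM H^o Y} := (a \o r) \- idfun.
have [|c cE] := linear_descent (f := c0) qs.
  by move=> t /qker[x ->]; rewrite /= rj aE subrr.
exists O, ⟦f⟧, ⟦g⟧; split; rewrite [LHS]stable_comp_class.
  apply: (stable_eq (a := d) (b := proj O)).
  apply: (@shift_ext k H Lam A O (shift_obj Lam O) (g \o f) (idfun \+ (proj O \o d))).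
  move=> t /=; rewrite fE /= gE /= dE /= (linearB (proj O)).
  by rewrite addrC subrK.
apply: (stable_eq (a := c) (b := q)) => y.
have [t <-] := qs y.
by rewrite /= gE /= fE /= cE /= (linearB q) addrC subrK.
Qed.

Lemma shift_autoequivalence : is_autoequivalence T.
Proof.
apply: ff_es_autoequivalence; first exact: shift_additive.1.
- exact: shift_full.
- exact: shift_faithful.
- exact: shift_essentially_surjective.
Qed.

End ShiftFunctor.

(** * From standard to distinguished triangles *)

Section StandardTriangles.
Variables (C : preaddCat) (T : endo C) (std : triangle T -> Prop).
Hypothesis Tadd : is_additive_functor T.

Definition iso_closure (S : triangle T) : Prop :=
  exists S', std S' /\ triangle_iso S S'.
Local Notation dist := iso_closure.

Let T1 X : emap T (idm X) = idm (T X) := Tadd.1.1 X.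
Let TM X Y Z (g : hom Y Z) (f : hom X Y) : emap T (g ∘ f) = emap T g ∘ emap T f :=
  Tadd.1.2 X Y Z g f.
Let TD X Y (f g : hom X Y) : emap T (f + g) = emap T f + emap T g :=
  Tadd.2 X Y f g.

Lemma emap_iso X Y (f : hom X Y) : is_iso f -> is_iso (emap T f).
Proof. by move=> [g [gf fg]]; exists (emap T g); rewrite -!TM gf fg !T1. Qed.

Lemma triangle_iso_refl (S : triangle T) : triangle_iso S S.
Proof.
exists (idm _), (idm _), (idm _); split; first by split; exact: is_iso_id.
by rewrite T1 !comp1m !compm1.
Qed.

Lemma triangle_iso_trans (S S' S'' : triangle T) :
  triangle_iso S S' -> triangle_iso S' S'' -> triangle_iso S S''.
Proof.
move=> [f [g [h [[fi gi hi] [E1 E2 E3]]]]] [f' [g' [h' [[fi' gi' hi'] [E1' E2' E3']]]]].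
exists (f' ∘ f), (g' ∘ g), (h' ∘ h); split; first by split; exact: is_iso_comp.
split.
- by rewrite -compA E1 compA E1' compA.
- by rewrite -compA E2 compA E2' compA.
- by rewrite TM -compA E3 compA E3' compA.
Qed.

Lemma iso_closure_std S : std S -> dist S.
Proof. by exists S; split=> //; exact: triangle_iso_refl. Qed.

Lemma iso_closure_iso S S' : triangle_iso S S' -> dist S' -> dist S.
Proof.
move=> SS' [S'' [sS i]]; exists S''; split=> //; exact: triangle_iso_trans i.
Qed.

Hypothesis std_id : forall X : C, exists (Z : C) (v : hom X Z) (w : hom Z (T X)),
  is_zero_object Z /\ std (Triangle (idm X) v w).
Hypothesis std_cone : forall (X Y : C) (u : hom X Y),
  exists (Z : C) (v : hom Y Z) (w : hom Z (T X)), std (Triangle u v w).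
Hypothesis std_fill : forall S S', std S -> std S' ->
  forall (f : hom (trX S) (trX S')) (g : hom (trY S) (trY S')),
  g ∘ tru S = tru S' ∘ f ->
  exists h, h ∘ trv S = trv S' ∘ g /\ emap T f ∘ trw S = trw S' ∘ h.
Hypothesis std_weak_cokernel : forall S, std S ->
  forall (D : C) (d : hom (trZ S) D), d ∘ trv S = 0 -> exists q, d = q ∘ trw S.
Hypothesis std_rotate : forall S, std S ->
  dist (Triangle (trv S) (trw S) (- emap T (tru S))).
Hypothesis std_octahedron : forall (X Y Z : C) (u : hom X Y) (v : hom Y Z),
  exists (Z' X' Y' : C) (j : hom Y Z') (k : hom Z' (T X))
    (l : hom Z X') (i : hom X' (T Y)) (m : hom Z Y') (n : hom Y' (T X))
    (f : hom Z' Y') (g : hom Y' X'),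
  [/\ std (Triangle u j k), std (Triangle v l i), std (Triangle (v ∘ u) m n),
      dist (Triangle f g (emap T j ∘ i)) &
      [/\ f ∘ j = m ∘ v, n ∘ f = k, g ∘ m = l & i ∘ g = emap T u ∘ n]].


Lemma inverse_square (X Y X' Y' : C) (u : hom X Y) (u' : hom X' Y')
    (f : hom X X') (f' : hom X' X) (g : hom Y Y') (g' : hom Y' Y) :
  g' ∘ g = idm Y -> f ∘ f' = idm X' -> g ∘ u = u' ∘ f -> g' ∘ u' = u ∘ f'.
Proof.
move=> g'g ff' E.
by rewrite -[u']compm1 -ff' (compA u') -E !compA g'g comp1m.
Qed.

Lemma paste_squares (X Y X' Y' X'' Y'' : C) (u : hom X Y) (u' : hom X' Y')
    (u'' : hom X'' Y'') (f : hom X X') (f' : hom X' X'') (g : hom Y Y')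
    (g' : hom Y' Y'') : g ∘ u = u' ∘ f -> g' ∘ u' = u'' ∘ f' ->
  g' ∘ g ∘ u = u'' ∘ (f' ∘ f).
Proof. by move=> E E'; rewrite -compA E compA E' compA. Qed.

Lemma dist_fill S S' : dist S -> dist S' ->
  forall (f : hom (trX S) (trX S')) (g : hom (trY S) (trY S')),
  g ∘ tru S = tru S' ∘ f ->
  exists h, h ∘ trv S = trv S' ∘ g /\ emap T f ∘ trw S = trw S' ∘ h.
Proof.
move=> [S1 [sS [a [b [c [[[a' [a'a aa']] [b' [b'b bb']] _] [Ea Eb Ec]]]]]]].
move=> [R1 [sR [p [q [r [[[p' [p'p pp']] [q' [q'q qq']] [r' [r'r rr']]] [Ep Eq Er]]]]]]].
move=> f g gf.
have [h [hv hw]] := std_fill sS sR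
  (paste_squares (paste_squares (inverse_square b'b aa' Ea) gf) Ep).
have Tp'p : emap T p' ∘ emap T p = idm _ by rewrite -TM p'p T1.
exists (r' ∘ (h ∘ c)); split.
  rewrite (paste_squares (paste_squares Eb hv) (inverse_square r'r qq' Eq)).
  by rewrite -!compA b'b compm1 (compA q') q'q comp1m.
have := paste_squares (paste_squares Ec hw) (inverse_square Tp'p rr' Er).
by rewrite -!TM -!compA a'a compm1 (compA p') p'p comp1m.
Qed.

Lemma dist_weak_cokernel S : dist S ->
  forall (D : C) (d : hom (trZ S) D), d ∘ trv S = 0 -> exists q, d = q ∘ trw S.
Proof.
move=> [S1 [sS [a [b [c [[_ [b' [b'b bb']] [c' [c'c cc']]] [_ Eb Ec]]]]]]] D d d0.
have [|q qE] := std_weak_cokernel sS (d := d ∘ c').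
  by rewrite -compA (inverse_square c'c bb' Eb) compA d0 comp0m.
exists (q ∘ emap T a).
by rewrite -compA Ec compA -qE -compA c'c compm1.
Qed.

(** [n = h - 1] vanishes on [v], so it factors through [w]; since [w n = 0], this
    gives [n n = 0] and [1 - n] is the inverse. *)
Lemma dist_endo_iso S (h : hom (trZ S) (trZ S)) : dist S ->
  h ∘ trv S = trv S -> trw S ∘ h = trw S -> is_iso h.
Proof.
move=> dS hv hw; have [|q qE] := dist_weak_cokernel dS (d := h - idm _).
  by rewrite compBl hv comp1m subrr.
pose n := h - idm _.
have nn : n ∘ n = 0.
  by rewrite {1}/n qE -compA compBr hw compm1 subrr compm0.
have -> : h = idm _ + n by rewrite /n addrC subrK.
exists (idm _ - n); split.
  by rewrite compBl comp1m compDr compm1 nn addr0 addrK.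
by rewrite compDl comp1m compBr compm1 nn subr0 subrK.
Qed.

Lemma iso_of_retract (X Y : C) (f : hom X Y) (g : hom Y X) :
  is_iso (g ∘ f) -> is_iso (f ∘ g) -> is_iso f.
Proof.
move=> [a [a1 _]] [b [_ b2]].
have E : a ∘ g = g ∘ b.
  by rewrite -[a ∘ g]compm1 -b2 -(compA f) compA -(compA a) a1 comp1m.
by exists (a ∘ g); split; [rewrite -compA a1|rewrite E compA b2].
Qed.

Lemma dist_cone_unique (X Y Z Z' : C) (u : hom X Y) (v : hom Y Z)
    (w : hom Z (T X)) (v' : hom Y Z') (w' : hom Z' (T X)) :
  dist (Triangle u v w) -> dist (Triangle u v' w') ->
  exists h : hom Z Z', [/\ is_iso h, h ∘ v = v' & w' ∘ h = w].
Proof.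
move=> dS dS'.
have E : idm Y ∘ u = u ∘ idm X by rewrite comp1m compm1.
have [h [/= hv hw]] := dist_fill dS dS' E.
have [h' [/= hv' hw']] := dist_fill dS' dS E.
move: hv hw hv' hw'; rewrite !T1 !comp1m !compm1 => hv hw hv' hw'.
exists h; split=> //; apply: (@iso_of_retract _ _ h h').
  apply: (dist_endo_iso dS) => /=; first by rewrite -compA hv hv'.
  by rewrite compA -hw' -hw.
apply: (dist_endo_iso dS') => /=; first by rewrite -compA hv' hv.
by rewrite compA -hw -hw'.
Qed.

Lemma dist_rotate (X Y Z : C) (u : hom X Y) (v : hom Y Z) (w : hom Z (T X)) :
  dist (Triangle u v w) -> dist (Triangle v w (- emap T u)).
Proof.
move=> [S1 [sS [a [b [c [[ai bi ci] [/= Ea Eb Ec]]]]]]].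
apply: iso_closure_iso (std_rotate sS).
exists b, c, (emap T a); split; first by split=> //; exact: emap_iso.
by split=> //=; rewrite compmN compNm -!TM Ea.
Qed.

Hypothesis Tfull : forall (X Y : C) (h : hom (T X) (T Y)), exists g, emap T g = h.
Hypothesis Tfaithful : forall (X Y : C) (f g : hom X Y), emap T f = emap T g -> f = g.

(** Two more rotations give triangles on [- T u], [- T v], [- T w].  Compare with
    the same rotation of a standard triangle on [u]: by uniqueness of cones there
    is an isomorphism between the third vertices, and it descends along [T]. *)
Lemma dist_unrotate (X Y Z : C) (u : hom X Y) (v : hom Y Z) (w : hom Z (T X)) :
  dist (Triangle v w (- emap T u)) -> dist (Triangle u v w).
Proof.
move=> /dist_rotate/dist_rotate d1.
have [Z' [v' [w' sS]]] := std_cone u.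
have dS := iso_closure_std sS.
have d2 := dist_rotate (dist_rotate (dist_rotate dS)).
have [h [[hI [hIh hhI]] hv hw]] := dist_cone_unique d1 d2.
have [g gE] := Tfull h; have [gI gIE] := Tfull hI; subst h hI.
apply: iso_closure_iso dS; exists (idm X), (idm Y), g; split.
  split; try exact: is_iso_id.
  by exists gI; split; apply: Tfaithful; rewrite TM T1.
split => /=; rewrite ?T1 ?comp1m ?compm1 //; apply: Tfaithful; rewrite TM.
  by apply: oppr_inj; rewrite -compmN.
by apply: oppr_inj; rewrite -hw compNm.
Qed.

(** The axioms only have to be checked on standard triangles, and the octahedral
    axiom on one choice of the three cones.  Rotating backwards is for free as
    [T] is fully faithful. *)
Lemma triangulated_of_standard :
  is_additive_category C -> is_autoequivalence T -> triangulated dist.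
Proof.
move=> Cadd Taut; split=> //.
- exact: iso_closure_iso.
- move=> X Z Z0; have [Z' [v [w [Z'0 sS]]]] := std_id X.
  apply: iso_closure_iso (iso_closure_std sS).
  exists (idm X), (idm X), 0; split.
    split; try exact: is_iso_id.
    by exists 0; split; [rewrite ((Z0 Z).1 (idm Z)) comp0m
                        |rewrite ((Z'0 Z').1 (idm Z')) comp0m].
  by split; rewrite /= ?compm1 ?comp0m ?compm0 // ((Z'0 X).1 v).
- move=> X Y u; have [Z [v [w sS]]] := std_cone u.
  by exists Z, v, w; exact: iso_closure_std.
- by move=> X Y Z u v w; split; [exact: dist_rotate|exact: dist_unrotate].
- move=> X Y Z X' Y' Z' u v w u' v' w' f g d d' E.
  exact: (dist_fill d d' E).
- move=> X Y Z X' Y' Z' u j k v l i m n dj dl dm.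
  have [Z1 [X1 [Y1 [j1 [k1 [l1 [i1 [m1 [n1 [f1 [g1 [sj sl sm dd [E1 E2 E3 E4]]]]]]]]]]]]]
    := std_octahedron u v.
  have [a [ai aj ka]] := dist_cone_unique dj (iso_closure_std sj).
  have [b [bi bl ib]] := dist_cone_unique dl (iso_closure_std sl).
  have [c [ci cm nc]] := dist_cone_unique dm (iso_closure_std sm).
  have [c' [c'c cc']] := ci; have [b' [b'b bb']] := bi.
  exists (c' ∘ f1 ∘ a), (b' ∘ g1 ∘ c); split.
    apply: iso_closure_iso dd; exists a, c, b; split=> //; split => /=.
    + by rewrite !compA cc' comp1m.
    + by rewrite !compA bb' comp1m.
    + by rewrite compA -TM aj -compA ib.
  split.
  + by rewrite -!compA aj E1 -cm !compA c'c comp1m.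
  + by rewrite -nc !compA -(compA n1) cc' compm1 E2.
  + by rewrite -!compA cm E3 -bl !compA b'b comp1m.
  + by rewrite -ib !compA -(compA i1) bb' compm1 E4 -compA nc.
Qed.

End StandardTriangles.

(** * Cones of module maps *)

Section LinearProduct.
Variables (R : pzRingType) (M N : lmodType R).

Lemma product_maps : exists (i : {linear M -> (M * N)%type})
    (j : {linear N -> (M * N)%type}) (p : {linear (M * N)%type -> M})
    (q : {linear (M * N)%type -> N}),
  [/\ forall x, i x = (x, 0), forall y, j y = (0, y),
      forall z, p z = z.1 & forall z, q z = z.2].
Proof.
have il : linear (fun x : M => (x, 0 : N)).
  by move=> a x y; rewrite -[RHS]/(_, a *: 0 + 0) scaler0 addr0.
have jl : linear (fun y : N => (0 : M, y)).
  by move=> a x y; rewrite -[RHS]/(a *: 0 + 0, _) scaler0 addr0.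
have pl : linear (fun z : M * N => z.1) by [].
have ql : linear (fun z : M * N => z.2) by [].
pose i : {linear M -> (M * N)%type} :=
  HB.pack (fun x : M => (x, 0 : N)) (GRing.isLinear.Build _ _ _ _ _ il).
pose j : {linear N -> (M * N)%type} :=
  HB.pack (fun y : N => (0 : M, y)) (GRing.isLinear.Build _ _ _ _ _ jl).
pose p : {linear (M * N)%type -> M} :=
  HB.pack (fun z : M * N => z.1) (GRing.isLinear.Build _ _ _ _ _ pl).
pose q : {linear (M * N)%type -> N} :=
  HB.pack (fun z : M * N => z.2) (GRing.isLinear.Build _ _ _ _ _ ql).
by exists i, j, p, q.
Qed.
End LinearProduct.

Section Cones.
Variables (k : fieldType) (H : hopfAlgType k) (Lam : H) (A : comodAlgType H).
Hypotheses (intL : left_integral Lam) (fdH : finite_dimensional (restr H^o)).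
Local Notation Lam' := (Lam : H^o).
Local Notation C := (stable_cat A).
Local Notation T := (stable_shift Lam A).
Local Notation proj := (shift_proj Lam).
Local Notation Tm := (shift_map Lam).
Local Notation "⟦ f ⟧" := (stable_class f).
Local Notation I M := (tensM H^o M).

(** A pushout in the form in which it is used: existence and uniqueness of the
    induced maps are separated, and the equations are pointwise. *)
Record is_cone (X Y Z : lmodType A) (u : {linear X -> Y}) (v : {linear Y -> Z})
    (b : {linear I X -> Z}) (w : {linear Z -> shift_obj Lam X}) : Prop := IsCone {
  cone_comm : forall x, b (tens_pure Lam' x) = v (u x);
  cone_map : forall (D : lmodType A) (f : {linear I X -> D}) (g : {linear Y -> D}),
    (forall x, f (tens_pure Lam' x) = g (u x)) ->
    exists h : {linear Z -> D}, (forall a, h (b a) = f a) /\ forall y, h (v y) = g y;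
  cone_ext : forall (D : lmodType A) (h h' : {linear Z -> D}),
    (forall a, h (b a) = h' (b a)) -> (forall y, h (v y) = h' (v y)) -> h =1 h';
  cone_projE : forall a, w (b a) = proj X a;
  cone_proj0 : forall y, w (v y) = 0
}.

Lemma standard_coneP (S : triangle T) : standard_triangle intL S <->
  exists (X Y Z : lmodType A) (u : {linear X -> Y}) (v : {linear Y -> Z})
    (b : {linear I X -> Z}) (w : {linear Z -> shift_obj Lam X}),
    is_cone u v b w /\ S = Triangle (T := T) (trX := X) (trY := Y) (trZ := Z)
      ⟦u⟧ ⟦v⟧ ⟦w⟧.
Proof.
split=> [[X [Y [Z [u [v [b [w [[bc po] wb wv ->]]]]]]]]|]; last first.
  move=> [X [Y [Z [u [v [b [w [[bc po ext wb wv] ->]]]]]]]].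
  exists X, Y, Z, u, v, b, w; split=> //; split=> // D f g fg.
  have [h [hb hv]] := po D f g fg.
  exists h; split=> // h' h'b h'v; apply: ext => x.
    by rewrite hb; exact: h'b.
  by rewrite hv; exact: h'v.
exists X, Y, Z, u, v, b, w; split=> //; split=> //.
- by move=> D f g fg; have [h [hb hv _]] := po D f g fg; exists h.
- move=> D h h' hb hv.
  have [|g [gb gv gu]] := po D (h' \o b) (h' \o v).
    by move=> x /=; congr (h' _); exact: bc.
  move=> z; rewrite (gu h) // (gu h') //.
Qed.

Lemma cone_exists (X Y : lmodType A) (u : {linear X -> Y}) :
  exists (Z : lmodType A) (v : {linear Y -> Z}) (b : {linear I X -> Z})
    (w : {linear Z -> shift_obj Lam X}), is_cone u v b w.
Proof.
have [i [j [p [q [iE jE pE qE]]]]] := product_maps (I X) Y.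
pose W : lmodType A := (I X * Y)%type.
pose S (z : W) : Prop := exists x, z = (tens_pure Lam' x, - u x).
pose cl : {linear W -> quotmod S} := quot_class S.
pose b : {linear I X -> quotmod S} := cl \o i.
pose v : {linear Y -> quotmod S} := cl \o j.
have clE z : cl z = b z.1 + v z.2.
  rewrite /= -linearD iE jE; congr (quot_class _ _).
  by case: z => x y; congr pair; rewrite /= ?addr0 ?add0r.
have clsurj y : exists x, cl x = y by exists (quot_repr y); exact: quot_reprK.
have comm x : b (tens_pure Lam' x) = v (u x).
  apply/quot_classP; rewrite iE jE; apply: mem_span; exists x.
  by congr pair; rewrite /= ?subr0 ?sub0r.
have map (D : lmodType A) (f : {linear I X -> D}) (g : {linear Y -> D}) :
    (forall x, f (tens_pure Lam' x) = g (u x)) ->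
    exists h : {linear quotmod S -> D},
      (forall a, h (b a) = f a) /\ forall y, h (v y) = g y.
  move=> fg; pose F : {linear W -> D} := (f \o p) \+ (g \o q).
  have [|h hE] := linear_descent (f := F) clsurj.
    move=> z; rewrite -(linear0 cl) => /quot_classP; rewrite subr0.
    move: z; apply: span_ind => [_ [x ->]||x y Fx Fy|a x Fx].
    - by rewrite /F /= pE qE /= fg linearN subrr.
    - exact: linear0.
    - by rewrite linearD Fx Fy addr0.
    - by rewrite linearZ_LR Fx scaler0.
  exists h; split=> x.
    by rewrite hE /F /= pE qE iE /= (linear0 g) addr0.
  by rewrite hE /F /= pE qE jE /= (linear0 f) add0r.
have [|w [wb wv]] := map _ (proj X) (\0 : {linear Y -> shift_obj Lam X}).
  by move=> x; rewrite (shift_proj_integral intL).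
exists (quotmod S), v, b, w; split=> // D h h' hb hv z.
by have [t <-] := clsurj z; rewrite clE !linearD hb hv.
Qed.

End Cones.

(** * The stable category is triangulated *)

(* Full simplification would also unfold the operations of the stable
   category. *)
Ltac simpl_triangle := cbv beta iota delta [trX trY trZ tru trv trw].

Section StableTriangles.
Variables (k : fieldType) (H : hopfAlgType k) (Lam : H) (A : comodAlgType H).
Hypotheses (intL : left_integral Lam) (fdH : finite_dimensional (restr H^o)).
Local Notation Lam' := (Lam : H^o).
Local Notation C := (stable_cat A).
Local Notation T := (stable_shift Lam A).
Local Notation proj := (shift_proj Lam).
Local Notation Tm := (shift_map Lam).
Local Notation "⟦ f ⟧" := (stable_class f).
Local Notation I M := (tensM H^o M).
Local Notation std := (standard_triangle (A := A) intL).
Local Notation dist := (distinguished (A := A) intL).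

Lemma stable_class_comp (X Y Z : lmodType A) (g : {linear Y -> Z})
    (f : {linear X -> Y}) :
  @comp C X Y Z ⟦g⟧ ⟦f⟧ = ⟦g \o f⟧.
Proof. exact: stable_comp_class. Qed.

Lemma stable_class0 (X Y : lmodType A) :
  ⟦(\0 : {linear X -> Y})⟧ = 0.
Proof.
apply: (addIr ⟦(\0 : {linear X -> Y})⟧); rewrite add0r -stable_classD.
by apply: eq_stable_class => x /=; rewrite addr0.
Qed.

Lemma stable_classN (X Y : lmodType A) (f : {linear X -> Y}) :
  ⟦\- f⟧ = - ⟦f⟧.
Proof.
apply: (addIr ⟦f⟧); rewrite addNr -stable_classD -stable_class0.
by apply: eq_stable_class => x /=; rewrite addNr.
Qed.

Lemma stable_additive : is_additive_category C.
Proof.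
split.
  pose Z : lmodType A := quotmod (fun _ : A^o => True).
  have Z0 (z : Z) : z = 0.
    rewrite -[z]quot_reprK -[RHS](linear0 (quot_class (fun _ : A^o => True))).
    by apply/quot_classP; exact: mem_span.
  exists Z => X; split=> F; have [f ->] := stable_surj F;
    rewrite -[RHS]stable_class0; apply: eq_stable_class => x /=.
    by rewrite (Z0 (f x)).
  by rewrite (Z0 x) linear0.
move=> X Y; pose P : lmodType A := (X * Y)%type.
have [i [j [p [q [iE jE pE qE]]]]] := product_maps X Y.
exists P, ⟦i⟧, ⟦j⟧, ⟦p⟧, ⟦q⟧.
split; rewrite !stable_class_comp.
- by apply: eq_stable_class => x; rewrite /= pE iE.
- by apply: eq_stable_class => x; rewrite /= qE jE.
- by rewrite -[RHS]stable_class0; apply: eq_stable_class => x; rewrite /= pE jE.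
- by rewrite -[RHS]stable_class0; apply: eq_stable_class => x; rewrite /= qE iE.
- rewrite -stable_classD; apply: eq_stable_class => -[x y].
  by rewrite /= pE qE iE jE; congr pair; rewrite /= ?addr0 ?add0r.
Qed.

Lemma standard_cone (X Y : C) (u : hom X Y) :
  exists (Z : C) (v : hom Y Z) (w : hom Z (T X)), std (Triangle u v w).
Proof.
have [f ->] := stable_surj u.
have [Z [v [b [w c]]]] := cone_exists intL f.
exists Z, ⟦v⟧, ⟦w⟧; apply/(standard_coneP intL).
by exists X, Y, Z, f, v, b, w.
Qed.

(** The cone of the identity is a retract of [H ⊗ X], hence stably zero. *)
Lemma standard_id (X : C) : exists (Z : C) (v : hom X Z) (w : hom Z (T X)),
  is_zero_object Z /\ std (Triangle (idm X) v w).
Proof.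
have [Z [v [b [w c]]]] := cone_exists intL (idfun : {linear X -> X}).
exists Z, ⟦v⟧, ⟦w⟧; split; last first.
  by apply/(standard_coneP intL); exists X, X, Z, idfun, v, b, w.
have [//|t [tb tv]] := cone_map c (f := idfun) (g := integral_incl intL X).
have id0 : idm (Z : C) = 0.
  rewrite -[RHS]stable_class0; apply: (stable_eq (a := t) (b := b)).
  apply: (cone_ext c (h' := (\0 : {linear Z -> Z}) \+ (b \o t))) => y /=.
    by rewrite tb add0r.
  by rewrite tv add0r (cone_comm c).
move=> Y; split=> f.
  by rewrite -[f]comp1m id0 comp0m.
by rewrite -[f]compm1 id0 compm0.
Qed.

(** If [g u = u' f + s iota], the map of cones is [v' g] on [Y] and [b' (I f) + v' s]
    on [I X]. *)
Lemma standard_fill (S S' : triangle T) : std S -> std S' ->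
  forall (f : hom (trX S) (trX S')) (g : hom (trY S) (trY S')),
  g ∘ tru S = tru S' ∘ f ->
  exists h, h ∘ trv S = trv S' ∘ g /\ emap T f ∘ trw S = trw S' ∘ h.
Proof.
move=> /(standard_coneP intL)[X [Y [Z [u [v [b [w [c ->]]]]]]]].
move=> /(standard_coneP intL)[X' [Y' [Z' [u' [v' [b' [w' [c' ->]]]]]]]].
simpl_triangle.
move=> F G; have [f ->] := stable_surj F; have [g ->] := stable_surj G.
move=> E; have [s sE] : exists s : {linear I X -> Y'},
    forall x, (g \o u) x = (u' \o f) x + s (tens_pure Lam' x).
  by apply/(stable_eqP intL fdH); rewrite -!stable_class_comp.
have {}sE x : g (u x) = u' (f x) + s (tens_pure Lam' x) := sE x.
have [|h [hb hv]] := cone_map c (f := (b' \o freemap f) \+ (v' \o s)) (g := v' \o g).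
  by move=> x; rewrite /= freemap_pure (cone_comm c') sE linearD.
exists ⟦h⟧; rewrite (emap_shift intL fdH) !stable_class_comp.
split; apply: eq_stable_class; first by move=> y; rewrite /= hv.
apply: (cone_ext c (h := Tm f \o w) (h' := w' \o h)) => y /=.
  rewrite (cone_projE c) hb /= (linearD w') (cone_projE c') (cone_proj0 c') addr0.
  by rewrite shift_map_proj.
by rewrite (cone_proj0 c) (linear0 (Tm f)) hv /= (cone_proj0 c').
Qed.

(** The inclusion of [Y] in [I Y] and [I u] on [I X] glue to a map from the cone of
    [u]; corrections through it appear in all stable identities below. *)
Lemma cone_to_free (X Y Z : lmodType A) (u : {linear X -> Y}) (v : {linear Y -> Z})
    (b : {linear I X -> Z}) (w : {linear Z -> shift_obj Lam X}) :
  is_cone u v b w -> exists e : {linear Z -> I Y},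
    (forall a, e (b a) = freemap u a) /\ forall y, e (v y) = tens_pure Lam' y.
Proof.
move=> c; have [|e [eb ev]] := cone_map c (f := freemap u) (g := integral_incl intL Y).
  by move=> x; rewrite freemap_pure.
by exists e.
Qed.

(** If [d v = s iota], then [d - s e], with [e] from [cone_to_free], vanishes on [v]
    exactly and so factors through [w]. *)
Lemma standard_weak_cokernel (S : triangle T) : std S ->
  forall (D : C) (d : hom (trZ S) D), d ∘ trv S = 0 -> exists q, d = q ∘ trw S.
Proof.
move=> /(standard_coneP intL)[X [Y [Z [u [v [b [w [c ->]]]]]]]] D.
simpl_triangle => F.
have [d ->] := stable_surj F.
rewrite stable_class_comp -stable_class0 => /(stable_eqP intL fdH)[s sE].
have dv y : d (v y) = s (tens_pure Lam' y) by have := sE y; rewrite /= add0r.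
have [e [eb ev]] := cone_to_free c.
have [|q qE] := shift_descent intL fdH (f := (d \o b) \- (s \o freemap u)).
  by move=> x; rewrite /= freemap_pure (cone_comm c) dv subrr.
exists ⟦q⟧; rewrite stable_class_comp; apply: (stable_eq (a := e) (b := s)).
apply: (cone_ext c (h' := (q \o w) \+ (s \o e))) => y /=.
  by rewrite (cone_projE c) qE /= eb subrK.
by rewrite (cone_proj0 c) (linear0 q) add0r ev.
Qed.

(** The map [t : T X -> C_v] with [t (pi a) = v2 (b a) - b2 (I u a)] identifies the
    rotated triangle with the standard one on [v].  Its stable inverse [p] is [w]
    on [C_u] and zero on [I Y]. *)
Lemma standard_rotate (S : triangle T) : std S ->
  dist (Triangle (trv S) (trw S) (- emap T (tru S))).
Proof.
move=> /(standard_coneP intL)[X [Y [Z [u [v [b [w [c ->]]]]]]]].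
simpl_triangle.
have [Z2 [v2 [b2 [w2 c2]]]] := cone_exists intL v.
exists (Triangle (T := T) (trX := Y) (trY := Z) (trZ := Z2) ⟦v⟧ ⟦v2⟧ ⟦w2⟧); split.
  by apply/(standard_coneP intL); exists Y, Z, Z2, v, v2, b2, w2.
have [e [eb ev]] := cone_to_free c.
have [|t tE] := shift_descent intL fdH (f := (v2 \o b) \- (b2 \o freemap u)).
  by move=> x; rewrite /= freemap_pure (cone_comm c) (cone_comm c2) subrr.
have tw z : t (w z) = v2 z - b2 (e z).
  move: z; apply: (cone_ext c (h := t \o w) (h' := v2 \- (b2 \o e))) => y /=.
    by rewrite (cone_projE c) tE /= eb.
  by rewrite (cone_proj0 c) (linear0 t) ev (cone_comm c2) subrr.
have [|p [pb pv]] := cone_map c2 (f := \0) (g := w).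
  by move=> y; rewrite (cone_proj0 c).
pose ne : {linear Z -> I Y} := \- e.
pose nid : {linear I Y -> I Y} := \- idfun.
have [|a [ab av]] := cone_map c2 (f := nid) (g := ne).
  by move=> y; rewrite /= ev.
exists (idm _), (idm _), ⟦t⟧; split.
  split; try exact: is_iso_id.
  exists ⟦p⟧; rewrite !stable_class_comp; split.
    apply: eq_stable_class.
    apply: (@shift_ext k H Lam A X (shift_obj Lam X) (p \o t) idfun) => x.
    by rewrite /= tE (linearB p) /= pv pb (cone_projE c) subr0.
  apply: (stable_eq (a := a) (b := b2)).
  apply: (cone_ext c2 (h := t \o p) (h' := idfun \+ (b2 \o a))) => x /=.
    by rewrite pb (linear0 t) ab /= (linearN b2) subrr.
  by rewrite pv tw av /= (linearN b2).
split; simpl_triangle; rewrite ?comp1m ?compm1 //.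
  rewrite stable_class_comp; apply: (stable_eq (a := ne) (b := b2)) => z.
  by rewrite /= tw (linearN b2).
rewrite ((shift_additive A intL fdH).1.1 Y) comp1m (emap_shift intL fdH).
rewrite stable_class_comp -stable_classN; apply: eq_stable_class.
apply: (@shift_ext k H Lam A X (shift_obj Lam Y) (\- Tm u) (w2 \o t)) => x.
by rewrite /= tE (linearB w2) /= (cone_proj0 c2) (cone_projE c2) sub0r shift_map_proj.
Qed.

(** [f] and [g] are the evident maps between cones.  The third cone is compared
    with the cone [C_f] of [f] by [s : C_v -> C_f], given by [q m] on [Z] and
    [I j] on [I Y].  Its stable inverse [t] is [g] on [C_(v u)] and an extension
    [E] of [e : C_u -> I Y] on [I C_u]; the composites differ from the identities
    by maps through [I Y] and [I C_u]. *)
Lemma standard_octahedron (X Y Z : C) (u : hom X Y) (v : hom Y Z) :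
  exists (Z' X' Y' : C) (j : hom Y Z') (k : hom Z' (T X))
    (l : hom Z X') (i : hom X' (T Y)) (m : hom Z Y') (n : hom Y' (T X))
    (f : hom Z' Y') (g : hom Y' X'),
  [/\ std (Triangle u j k), std (Triangle v l i), std (Triangle (v ∘ u) m n),
      dist (Triangle f g (emap T j ∘ i)) &
      [/\ f ∘ j = m ∘ v, n ∘ f = k, g ∘ m = l & i ∘ g = emap T u ∘ n]].
Proof.
move: u v => U V; have [u ->] := stable_surj U; have [v ->] := stable_surj V.
have [Cu [j [ub [p cu]]]] := cone_exists intL u.
have [Cv [l [vb [i cv]]]] := cone_exists intL v.
have [Cw [m [wb [n cw]]]] := cone_exists intL (v \o u).
have [|f [fb fj]] := cone_map cu (f := wb) (g := m \o v).
  by move=> x; rewrite (cone_comm cw).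
have [|g [gb gm]] := cone_map cw (f := vb \o freemap u) (g := l).
  by move=> x; rewrite /= freemap_pure (cone_comm cv).
have [Cf [q [fbar [r cf]]]] := cone_exists intL f.
have [|s [sb sl]] := cone_map cv (f := fbar \o freemap j) (g := q \o m).
  by move=> y; rewrite /= freemap_pure (cone_comm cf) fj.
have [e [eb ej]] := cone_to_free cu.
have [E EE] := free_extension intL fdH e.
have [|t [tb tq]] := cone_map cf (f := vb \o E) (g := g).
  move=> z; rewrite /= EE; move: z.
  apply: (cone_ext cu (h := vb \o e) (h' := g \o f)) => y /=.
    by rewrite eb fb gb.
  by rewrite ej fj /= gm (cone_comm cv).
pose d0 : {linear I Y -> I Y} := (E \o freemap j) \- idfun.
have [|d dE] := shift_descent intL fdH (f := d0).
  by move=> y; rewrite /= freemap_pure EE ej subrr.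
pose K0 : {linear I X -> I Cu} :=
  (freemap j \o freemap u) \- (integral_incl intL Cu \o ub).
have [|K [Kb Km]] := cone_map cw (f := K0) (g := \0).
  move=> x; rewrite /= !freemap_pure (cone_comm cu).
  exact: subrr.
(* The two halves of the correction [L] agree on [C_u]. *)
have Kf z : freemap j (e z) - tens_pure Lam' z = K (f z).
  move: z; apply: (cone_ext cu
    (h := (freemap j \o e) \- integral_incl intL Cu) (h' := K \o f)) => y /=.
    by rewrite eb fb Kb.
  by rewrite ej freemap_pure fj /= Km; exact: subrr.
pose L0 : {linear I Cu -> I Cu} := (freemap j \o E) \- idfun.
have [|L [Lb Lq]] := cone_map cf (f := L0) (g := K).
  by move=> z; rewrite /= EE Kf.
have sg z : s (g z) = q z + fbar (K z).
  move: z; apply: (cone_ext cw (h := s \o g) (h' := q \+ (fbar \o K))) => y /=.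
    rewrite gb /= sb /= Kb /= (linearB fbar) -fb -(cone_comm cf).
    by rewrite addrC subrK.
  by rewrite gm sl /= Km (linear0 fbar) addr0.
exists Cu, Cv, Cw, ⟦j⟧, ⟦p⟧, ⟦l⟧, ⟦i⟧, ⟦m⟧, ⟦n⟧, ⟦f⟧, ⟦g⟧; split.
- by apply/(standard_coneP intL); exists X, Y, Cu, u, j, ub, p.
- by apply/(standard_coneP intL); exists Y, Z, Cv, v, l, vb, i.
- rewrite stable_class_comp; apply/(standard_coneP intL).
  by exists X, Z, Cw, (v \o u), m, wb, n.
- exists (Triangle (T := T) (trX := Cu) (trY := Cw) (trZ := Cf) ⟦f⟧ ⟦q⟧ ⟦r⟧); split.
    by apply/(standard_coneP intL); exists Cu, Cw, Cf, f, q, fbar, r.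
  exists (idm _), (idm _), ⟦s⟧; split.
    split; try exact: is_iso_id.
    exists ⟦t⟧; rewrite !stable_class_comp; split.
      apply: (stable_eq (a := d \o i) (b := vb)).
      apply: (cone_ext cv (h := t \o s) (h' := idfun \+ (vb \o (d \o i)))) => y /=.
        by rewrite sb /= tb /= (cone_projE cv) dE /= (linearB vb) addrC subrK.
      by rewrite sl /= tq gm (cone_proj0 cv) (linear0 d) (linear0 vb) addr0.
    apply: (stable_eq (a := L) (b := fbar)).
    apply: (cone_ext cf (h := s \o t) (h' := idfun \+ (fbar \o L))) => y /=.
      by rewrite tb /= sb /= Lb /= (linearB fbar) addrC subrK.
    by rewrite tq sg Lq.
  split; simpl_triangle; rewrite ?comp1m ?compm1 //.
    rewrite stable_class_comp; apply: (stable_eq (a := K) (b := fbar)) => z.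
    exact: sg.
  rewrite ((shift_additive A intL fdH).1.1 Cu) comp1m (emap_shift intL fdH).
  rewrite !stable_class_comp; apply: eq_stable_class.
  apply: (cone_ext cv (h := Tm j \o i) (h' := r \o s)) => y /=.
    by rewrite (cone_projE cv) sb /= (cone_projE cf) shift_map_proj.
  by rewrite (cone_proj0 cv) (linear0 (Tm j)) sl /= (cone_proj0 cf).
rewrite (emap_shift intL fdH) !stable_class_comp.
split; apply: eq_stable_class.
- by move=> y; rewrite /= fj.
- apply: (cone_ext cu (h := n \o f) (h' := p)) => y /=.
    by rewrite fb (cone_projE cw) (cone_projE cu).
  by rewrite fj /= (cone_proj0 cw) (cone_proj0 cu).
- by move=> z; rewrite /= gm.
- apply: (cone_ext cw (h := i \o g) (h' := Tm u \o n)) => y /=.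
    by rewrite gb /= (cone_projE cv) (cone_projE cw) shift_map_proj.
  by rewrite gm (cone_proj0 cv) (cone_proj0 cw) (linear0 (Tm u)).
Qed.

Lemma stable_triangulated : triangulated dist.
Proof.
apply: (triangulated_of_standard (std := std)).
- exact: shift_additive.
- exact: standard_id.
- exact: standard_cone.
- exact: standard_fill.
- exact: standard_weak_cokernel.
- exact: standard_rotate.
- exact: standard_octahedron.
- exact: shift_full.
- exact: shift_faithful.
- exact: stable_additive.
- exact: shift_autoequivalence.
Qed.

End StableTriangles.

Theorem theorem1 (k : fieldType) (H : hopfAlgType k)
    (fdH : finite_dimensional (restr H^o))
    (Lam : H) (intL : left_integral Lam) (A : comodAlgType H) :
  (forall (M N : lmodType A) (u : {linear M -> N}),
     emap (stable_shift Lam A) (stable_class u)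
     = stable_class (shift_map Lam u)) /\
  triangulated (C := stable_cat A) (T := stable_shift Lam A)
    (distinguished (Lam := Lam) (A := A) intL).
Proof.
split; first exact: emap_shift.
exact: stable_triangulated.
Qed.
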